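(* Fix $d\geq 1$ and a finite collection of (pairwise) non-isomorphic graphs $F_1, F_2, \ldots, F_d$. Let $G_n = (V(G_n), E(G_n))$, $n\ge 1$, be a sequence of graphs with $|E(G_n)|\to\infty$, whose edges are colored uniformly at random with $c_n$ colors, where $c_n\to\infty$, such that for all $1 \leq i \leq d$ there exists a constant $\lambda_i \geq 0$ with $$\lim_{n \to \infty}\mathbb{E}\, R(F_i, G_n) = \lim_{n \to \infty}\mathrm{Var}\, R(F_i, G_n) = \lambda_i.$$ Then, as $n \to \infty$, $(R(F_1, G_n), \ldots, R(F_d, G_n))^\top$ converges in distribution to $(Z_1, \ldots, Z_d)^\top$, where $Z_1 \sim \mathrm{Pois}(\lambda_1), \ldots, Z_d \sim \mathrm{Pois}(\lambda_d)$ are independent.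
   Context: Graphs are finite and simple. In a uniformly random edge coloring of $G_n$ with $c_n$ colors, each edge $e\in E(G_n)$ has each color $a\in\{1,\dots,c_n\}$ with probability $1/c_n$, independently of the other edges. A copy of $F$ in $G_n$ is a (not necessarily induced) subgraph of $G_n$ isomorphic to $F$; it is monochromatic if all of its edges have the same color. $R(F,G_n)$ is the number of monochromatic copies of $F$ in $G_n$. $\mathrm{Pois}(0)$ is the point mass at $0$. *)

(* Defs.v *)
From HB Require Import structures.
From mathcomp Require Import all_boot all_order all_algebra.
From mathcomp Require Import all_classical all_reals all_analysis.

Set Implicit Arguments.
Unset Strict Implicit.
Unset Printing Implicit Defensive.

Import Order.TTheory GRing.Theory Num.Theory.
Import numFieldTopology.Exports numFieldNormedType.Exports.

Local Open Scope classical_set_scope.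
Local Open Scope ring_scope.

(* An edge is the set of its two endpoints. *)
Record sgraph := SGraph {
  vert : finType;
  edges : {set {set vert}};
  edges_card2 : forall e, e \in edges -> #|e| = 2%N }.

Definition isomorphic (F H : sgraph) : Prop :=
  exists f : vert F -> vert H,
    bijective f /\ [set f @: (e : {set vert F}) | e in edges F]%SET = edges H.

(* A subgraph of G is the pair S = (vertex set, edge set). The injection f is
   an isomorphism from F onto S; being onto S, it ensures that the edges in S.2
   have their endpoints in S.1. *)
Definition is_copy (F G : sgraph) (S : {set vert G} * {set {set vert G}}) :
    bool :=
  (S.2 \subset edges G) &&
  [exists f : {ffun vert F -> vert G},
     [&& injectiveb f, (f @: [set: vert F])%SET == S.1 &
         [set f @: (e : {set vert F}) | e in edges F]%SET == S.2]].

Definition monochromatic (V : finType) (C : eqType) (col : {set V} -> C)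
    (D : {set {set V}}) : bool :=
  [forall e in D, forall e' in D, col e == col e'].

(* R(F, G) for a given coloring; only the colors of the edges of G matter. *)
Definition mono_copies (F G : sgraph) (C : eqType) (col : {set vert G} -> C) :
    nat :=
  #|[set S | is_copy F S && monochromatic col S.2]%SET|.

(* Mutual independence of the family (X i), i in J. *)
Definition mutually_independent (R : realType) (d d' : measure_display)
    (T : measurableType d) (U : measurableType d') (P : probability T R)
    (I : finType) (J : {set I}) (X : I -> T -> U) : Prop :=
  forall (K : {set I}) (A : I -> set U), K \subset J ->
    (forall i, measurable (A i)) ->
    P (\bigcap_(i in [set` K]) (X i @^-1` A i)) =
    (\prod_(i in K) P (X i @^-1` A i))%E.

(* The colors of the edges of G are independent and uniform on {1, ..., c} (the
   c point masses 1/c add up to 1, so other colors have probability 0); the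
   values of chi on sets that are not edges are irrelevant. *)
Definition uniform_edge_coloring (R : realType) (d : measure_display)
    (T : measurableType d) (P : probability T R) (G : sgraph) (c : nat)
    (chi : {set vert G} -> {RV P >-> nat}) : Prop :=
  (forall e (a : nat), e \in edges G -> (1 <= a <= c)%N ->
     P [set w | chi e w = a] = (c%:R^-1)%:E) /\
  mutually_independent P (edges G) chi.

Definition mono_count (R : realType) (d : measure_display)
    (T : measurableType d) (P : probability T R) (F G : sgraph)
    (chi : {set vert G} -> {RV P >-> nat}) : T -> R :=
  fun w => (mono_copies F (fun e => chi e w))%:R.

(* Weak convergence of the laws, tested on bounded continuous functions; the
   X n may live on different probability spaces. *)
Definition cvg_in_distribution (R : realType) (k : nat)
    (d : nat -> measure_display) (T : forall n, measurableType (d n))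
    (P : forall n, probability (T n) R) (X : forall n, T n -> 'rV[R]_k)
    (d' : measure_display) (T' : measurableType d') (Q : probability T' R)
    (Z : T' -> 'rV[R]_k) : Prop :=
  forall f : 'rV[R]_k -> R, continuous f ->
    (exists M : R, forall x, `|f x| <= M) ->
    'E_(P n)[f \o X n]%E @[n --> \oo] --> 'E_Q[f \o Z]%E.

(* Main.v *)
Require Import Defs.
From HB Require Import structures.
From mathcomp Require Import all_boot all_order all_algebra.
From mathcomp Require Import all_classical all_reals all_analysis.
From mathcomp Require Import ring lra.

Set Implicit Arguments.
Unset Strict Implicit.
Unset Printing Implicit Defensive.

Import Order.TTheory GRing.Theory Num.Theory.
Import numFieldTopology.Exports numFieldNormedType.Exports.

Local Open Scope ring_scope.

(** A copy of [F i] is treated as its edge set, so that the problem becomes one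
on a finite ground set colored uniformly with [c] colors, carrying a family of
subsets [S a] of types [tau a]; [S a] is monochromatic with probability
[p a = c ^ (1 - #|S a|)].  Recoloring is so symmetric that monochromaticity of
[S a] is independent of all colors outside [S a] together with the color of one
chosen element of [S a] ([avg_mono_indep]).  Hence two members sharing at most one
element are independent, while two members sharing [t >= 2] elements are
positively correlated, with joint probability [c ^ (t - 1) * p a * p b].
The convergence of the variance and of the mean to the same limit therefore forces
the expected number of monochromatic pairs of the same type sharing at
least two elements to tend to 0 ([overlap_sum_le_variance]).

For two different types this is transferred by Cauchy-Schwarz, summing over the
common part [J] of the two members ([overlap_sum_le_energy]); the argument fails
only when members of two types have the same edge set.  For nonisomorphic graphs
this forces an isolated vertex in one of them ([same_edges_isomorphic]), and a graph
with an isolated vertex has limit 0, because each of its copies comes with a twin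
that has the same edges ([isolated_vertex_limit]).

The Poisson limit is the Stein-Chen method with a nonlocal dependence structure.
A plain dependency graph, joining members that meet, is too coarse: one edge of [G]
may lie in almost all copies.  But by the independence above, each member [S a]
may ignore one of its elements, its anchor [x a], and only the members that
meet [S a] elsewhere count as linked to it.  The anchor is chosen of maximal
degree; the degrees of the other elements are then controlled by Cauchy-Schwarz
through the pairs of members sharing two elements ([anchored_degree_sum_le]), so that
the Stein-Chen error is bounded by means and overlaps alone ([linked_sum_le]).

The test functions are indicators of points.  For these [stein_chen] says that the
law [a_n] of the vector of counts satisfies
[(y i + 1) * a_n (y + 1_i) - lambda i * a_n y --> 0].  The product Poisson law
satisfies this recursion exactly, so [a_n] is asymptotically proportional to it, and
tightness, which follows from the bounded means, fixes the constant of proportionality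
([point_mass_cvg]).  Pointwise convergence of the masses then gives convergence of the
expectation of each bounded function ([bounded_test_cvg]). *)

(** * Uniform colorings of a finite set *)

(** [monochromatic] on an arbitrary ground set: for [T := {set vert G}] the two
are convertible. *)
Definition mono (T : finType) (C : eqType) (col : T -> C) (D : {set T}) : bool :=
  [forall e in D, forall e' in D, col e == col e'].

Lemma monoP (T : finType) (C : eqType) (col : T -> C) (D : {set T}) :
  reflect {in D &, forall e e', col e = col e'} (mono col D).
Proof.
apply: (iffP forall_inP) => [h e e' eD e'D|h e eD].
  by apply/eqP/(forall_inP (h e eD)).
by apply/forall_inP => e' e'D; apply/eqP/h.
Qed.

Lemma mono_setU (T : finType) (C : eqType) (col : T -> C) (D D' : {set T}) :
  (0 < #|D :&: D'|)%N -> mono col (D :|: D') = mono col D && mono col D'.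
Proof.
move=> /card_gt0P[x]; rewrite inE => /andP[xD xD'].
apply/monoP/andP => [h|[/monoP h /monoP h']].
  by split; apply/monoP => e e' ? ?; apply: h; rewrite inE; apply/orP; auto.
suff hx e : e \in D :|: D' -> col e = col x by move=> e e' /hx-> /hx->.
by rewrite inE => /orP[/h|/h']; apply.
Qed.

Lemma mono0 (T : finType) (C : eqType) (col : T -> C) : mono col finset.set0.
Proof. by apply/monoP => e e'; rewrite inE. Qed.

Section Average.
Variables (R : rcfType) (T : finType) (c : nat).
Hypothesis c_gt0 : (0 < c)%N.
Local Notation coloring := {ffun T -> 'I_c}.

Definition avg (h : coloring -> R) : R := (\sum_phi h phi) / (c ^ #|T|)%:R.

(** The predecessor makes this right for the empty set as well, which is always
monochromatic. *)
Definition mono_prob (D : {set T}) : R := c%:R ^- #|D|.-1.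

Let cR_gt0 : 0 < c%:R :> R. Proof. by rewrite ltr0n. Qed.
Let cT_gt0 : 0 < (c ^ #|T|)%:R :> R. Proof. by rewrite ltr0n expn_gt0 c_gt0. Qed.

Lemma eq_avg h h' : h =1 h' -> avg h = avg h'.
Proof. by move=> hh'; rewrite /avg; under eq_bigr do rewrite hh'. Qed.

Lemma avg_cst k : avg (fun=> k) = k.
Proof.
rewrite /avg sumr_const card_ffun card_ord -[k *+ _]mulr_natr mulfK//.
by rewrite gt_eqF.
Qed.

Lemma avgD h h' : avg (fun phi => h phi + h' phi) = avg h + avg h'.
Proof. by rewrite /avg big_split mulrDl. Qed.

Lemma avgB h h' : avg (fun phi => h phi - h' phi) = avg h - avg h'.
Proof. by rewrite /avg sumrB mulrBl. Qed.

Lemma avgZ k h : avg (fun phi => k * h phi) = k * avg h.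
Proof. by rewrite /avg -mulr_sumr mulrA. Qed.

Lemma avg_sum (I : Type) (r : seq I) (P : pred I) (h : I -> coloring -> R) :
  avg (fun phi => \sum_(i <- r | P i) h i phi) = \sum_(i <- r | P i) avg (h i).
Proof. by rewrite /avg exchange_big mulr_suml. Qed.

Lemma le_avg h h' : (forall phi, h phi <= h' phi) -> avg h <= avg h'.
Proof. by move=> hh'; rewrite /avg ler_pM2r ?invr_gt0// ler_sum. Qed.

Lemma avg_ge0 h : (forall phi, 0 <= h phi) -> 0 <= avg h.
Proof. by move=> h0; rewrite -(avg_cst 0) le_avg. Qed.

Lemma ler_norm_avg h : `|avg h| <= avg (fun phi => `|h phi|).
Proof.
rewrite /avg normrM (gtr0_norm (x := _^-1)) ?invr_gt0// ler_pM2r ?invr_gt0//.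
exact: ler_norm_sum.
Qed.

(** A coloring that agrees with [phi0] on [B] is a free choice of colors
off [B]. *)
Lemma card_agree (B : {set T}) (phi0 : coloring) :
  #|[set phi : coloring | [forall e in B, phi e == phi0 e]]| = (c ^ #|~: B|)%N.
Proof.
pose F e := [pred a : 'I_c | (e \in B) ==> (a == phi0 e)].
have -> : #|[set phi : coloring | [forall e in B, phi e == phi0 e]]| = #|family F|.
  apply: eq_card => phi; rewrite inE.
  apply/forall_inP/familyP => [h e|h e eB].
    by rewrite !inE; apply/implyP => /h.
  by have := h e; rewrite !inE eB.
rewrite card_family foldrE big_map big_enum /=.
rewrite (bigID (mem B)) /= big1 ?mul1n; last first.
  move=> e eB; rewrite -(card1 (phi0 e)); apply: eq_card => a.
  by rewrite !inE eB.
rewrite -prod_nat_const; apply: eq_big => [e|e eB]; first by rewrite inE.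
rewrite -[RHS]card_ord; apply: eq_card => a.
by rewrite !inE (negbTE eB).
Qed.

(** Recolor [D] with the color of [x]: this maps all colorings onto those for
which [D] is monochromatic, each fibre has [c ^ (#|D| - 1)] elements, and the map
does not change [h]. *)
Lemma avg_mono_indep (D : {set T}) (x : T) (h : coloring -> R) : x \in D ->
    (forall phi psi : coloring,
       {in ~: (D :\ x), phi =1 psi} -> h phi = h psi) ->
  avg (fun phi => (mono phi D)%:R * h phi) = mono_prob D * avg h.
Proof.
move=> xD hD; rewrite /avg mulrA; congr (_ / _).
pose rho (phi : coloring) : coloring :=
  [ffun e => if e \in D then phi x else phi e].
have hrho phi : h phi = h (rho phi).
  apply: hD => e; rewrite !inE negb_and negbK ffunE.
  by case: (altP (e =P x)) => [->|_ /= /negbTE->//]; rewrite xD.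
have mono_rho phi : mono (rho phi) D.
  by apply/monoP => e e' eD e'D; rewrite !ffunE eD e'D.
rewrite [in RHS](eq_bigr _ (fun phi _ => hrho phi)).
rewrite [in RHS](partition_big rho (fun psi => mono psi D)) //= mulr_sumr.
rewrite [RHS]big_mkcond /=; apply: eq_bigr => psi _.
case: ifP => [mpsi|_]; last by rewrite mul0r.
rewrite mul1r (eq_bigr (fun=> h psi)) => [|phi /eqP->//].
have fiber phi : (rho phi == psi) = [forall e in ~: (D :\ x), phi e == psi e].
  apply/eqP/forall_inP => [<- e|agr].
    rewrite !inE negb_and negbK ffunE.
    by case: (altP (e =P x)) => [->|_ /= /negbTE->//]; rewrite xD.
  have phix : phi x = psi x by apply/eqP/agr; rewrite !inE eqxx.
  apply/ffunP => e; rewrite ffunE; case: ifP => eD.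
    by rewrite phix; exact: (monoP _ _ mpsi).
  by apply/eqP/agr; rewrite !inE eD andbF.
rewrite (eq_bigl (mem [set phi : coloring |
  [forall e in ~: (D :\ x), phi e == psi e]])); last first.
  by move=> phi; rewrite /= inE fiber.
rewrite sumr_const card_agree finset.setCK.
have -> : #|D :\ x| = #|D|.-1 by rewrite (cardsD1 x D) xD.
by rewrite /mono_prob -[h psi *+ _]mulr_natr natrX mulrCA mulVf ?mulr1// expf_neq0// gt_eqF.
Qed.

Lemma mono_prob_gt0 D : 0 < mono_prob D.
Proof. by rewrite invr_gt0 exprn_gt0. Qed.

Lemma avg_mono D : avg (fun phi => (mono phi D)%:R) = mono_prob D.
Proof.
have [->|[x xD]] := set_0Vmem D.
  rewrite /mono_prob cards0 expr0 invr1 -[RHS](avg_cst 1); apply: eq_avg => phi.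
  by rewrite mono0.
rewrite -[RHS]mulr1 -[X in _ * X](avg_cst 1) -(avg_mono_indep xD)//.
by apply: eq_avg => phi; rewrite mulr1.
Qed.

Definition joint_prob D D' :=
  avg (fun phi => (mono phi D)%:R * (mono phi D')%:R).

Lemma joint_prob_ge0 D D' : 0 <= joint_prob D D'.
Proof. by apply: avg_ge0 => phi; rewrite mulr_ge0. Qed.

(** Two sets that meet are both monochromatic exactly when their union is. *)
Lemma joint_prob_meet D D' : (0 < #|D :&: D'|)%N ->
  joint_prob D D' = mono_prob D * mono_prob D' * c%:R ^+ #|D :&: D'|.-1.
Proof.
move=> DD'0; rewrite /joint_prob.
under eq_avg do rewrite -natrM mulnb -mono_setU//.
rewrite avg_mono /mono_prob; have := cardsUI D D'.
have [D0 D'0] : (#|D :&: D'| <= #|D|)%N /\ (#|D :&: D'| <= #|D'|)%N.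
  by rewrite !subset_leq_card ?finset.subsetIl ?finset.subsetIr.
have [UD] : (#|D| <= #|D :|: D'|)%N by rewrite subset_leq_card ?finset.subsetUl.
move: #|D :&: D'| #|D :|: D'| #|D| #|D'| DD'0 D0 D'0 UD.
move=> [//|t] [|u] [|a] [|b] //= _ _ _ _; rewrite !addSn !addnS => -[] uab.
have cN k : c%:R ^+ k != 0 :> R by rewrite expf_neq0// gt_eqF.
by rewrite -invfM -exprD -uab exprD invfM divfK.
Qed.

Lemma joint_prob_indep D D' : (#|D :&: D'| <= 1)%N ->
  joint_prob D D' = mono_prob D * mono_prob D'.
Proof.
rewrite leq_eqVlt => /orP[/eqP t1|].
  by rewrite joint_prob_meet t1// expr0 mulr1.
rewrite ltnS leqn0 cards_eq0 => /eqP DD'0.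
have [D0|[x xD]] := set_0Vmem D.
  rewrite -!avg_mono /joint_prob D0.
  under eq_avg do rewrite mono0 mul1r.
  under [X in _ = X * _]eq_avg do rewrite mono0.
  by rewrite avg_cst mul1r.
rewrite /joint_prob (avg_mono_indep xD) ?avg_mono// => phi psi agr.
congr ((_ : bool)%:R); have eqD' e : e \in D' -> phi e = psi e.
  move=> eD'; apply: agr; rewrite !inE negb_and; apply/orP; right.
  by apply: contraT; rewrite negbK => eD; rewrite -(finset.in_set0 e) -DD'0 inE eD eD'.
by apply/monoP/monoP => mD e e' eD e'D; [rewrite -!eqD'|rewrite !eqD'] => //; apply: mD.
Qed.

End Average.

(** * Monochromatic members of a family of sets *)

(** Lagrange's identity: twice the difference of the two sides is the sum of the
squares [w i * w j * (x i * y j - x j * y i) ^ 2]. *)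
Lemma weighted_cauchy_schwarz (R : realFieldType) (I : finType) (P : pred I)
    (w x y : I -> R) : (forall i, P i -> 0 <= w i) ->
  (\sum_(i | P i) w i * (x i * y i)) ^+ 2 <=
  (\sum_(i | P i) w i * x i ^+ 2) * (\sum_(i | P i) w i * y i ^+ 2).
Proof.
move=> w0; set X := (leRHS); set Y := leLHS.
pose s (i j : I) := w i * w j * (x i * y j - x j * y i) ^+ 2.
have s0 : 0 <= \sum_(i | P i) \sum_(j | P j) s i j.
  apply: sumr_ge0 => i Pi; apply: sumr_ge0 => j Pj.
  by rewrite mulr_ge0 ?sqr_ge0// mulr_ge0// w0.
rewrite -subr_ge0 -(pmulr_rge0 _ (ltr0n R 2)) (le_trans s0)//.
(* The two terms X arise from each other by exchanging i and j. *)
have -> : \sum_(i | P i) \sum_(j | P j) s i j = X + X - Y - Y; last by lra.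
have XE : X = \sum_(i | P i) \sum_(j | P j) w i * x i ^+ 2 * (w j * y j ^+ 2).
  by rewrite /X big_distrlr.
have XE' : X = \sum_(i | P i) \sum_(j | P j) w j * x j ^+ 2 * (w i * y i ^+ 2).
  by rewrite XE exchange_big.
have YE : Y = \sum_(i | P i) \sum_(j | P j)
    w i * (x i * y i) * (w j * (x j * y j)).
  by rewrite /Y expr2 big_distrlr.
rewrite {1}XE XE' YE -big_split -!sumrB /=; apply: eq_bigr => i _.
rewrite -big_split -!sumrB /=; apply: eq_bigr => j _.
by rewrite /s; ring.
Qed.

Section Family.
Variables (R : rcfType) (T A : finType) (c d : nat).
Variables (S : A -> {set T}) (tau : A -> 'I_d).
Hypothesis c_gt0 : (0 < c)%N.
Local Notation coloring := {ffun T -> 'I_c}.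
Local Notation avg := (@avg R T c).
Local Notation p a := (mono_prob R c (S a)).
Local Notation q a b := (joint_prob R c (S a) (S b)).

Definition mono_number (phi : coloring) : {ffun 'I_d -> nat} :=
  [ffun i => \sum_(a | tau a == i) mono phi (S a)]%N.

Definition mean (i : 'I_d) : R := \sum_(a | tau a == i) p a.

Definition overlap a b := (1 < #|S a :&: S b|)%N.

(** Only pairs sharing at least two elements are correlated, so this is what
separates the family from an independent one; the proof consists in making it vanish
in the limit, for all [i] and [j]. *)
Definition overlap_sum (i j : 'I_d) : R :=
  \sum_(a | tau a == i) \sum_(b | [&& tau b == j, b != a & overlap a b]) q a b.

Let cR_gt0 : 0 < c%:R :> R. Proof. by rewrite ltr0n. Qed.
Let p_gt0 a : 0 < p a. Proof. exact: mono_prob_gt0. Qed.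
Let p_ge0 a : 0 <= p a. Proof. exact: ltW. Qed.
Let q_ge0 a b : 0 <= q a b. Proof. exact: joint_prob_ge0. Qed.

Lemma avg_mono_number i : avg (fun phi => (mono_number phi i)%:R) = mean i.
Proof.
under eq_avg do rewrite ffunE natr_sum.
by rewrite avg_sum; apply: eq_bigr => a _; rewrite avg_mono.
Qed.

Lemma joint_probxx (D : {set T}) : joint_prob R c D D = mono_prob R c D.
Proof.
rewrite -avg_mono//; apply: eq_avg => phi.
by case: (mono phi D); rewrite ?mulr1 ?mulr0.
Qed.

Lemma mono_prob_le (D : {set T}) : (1 < #|D|)%N -> mono_prob R c D <= c%:R^-1.
Proof.
rewrite /mono_prob; case: #|D| => [//|[//|k]] _ /=.
by rewrite lef_pV2 ?posrE ?exprn_gt0// ler_eXnr// ler1n.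
Qed.

(** The joint probability exceeds the product by the factor [c ^ (t - 1)], where
[t >= 2] is the size of the intersection. *)
Lemma overlap_mul_le a b : overlap a b -> c%:R * (p a * p b) <= q a b.
Proof.
move=> ab; rewrite joint_prob_meet ?(ltnW ab)// [leRHS]mulrC ler_pM2r ?mulr_gt0//.
move: ab; rewrite /overlap; case: #|_| => [//|[//|k]] _ /=.
by rewrite ler_eXnr// ler1n.
Qed.

Lemma overlap_le a b : overlap a b -> p a * p b <= q a b.
Proof.
move=> /overlap_mul_le; apply: le_trans.
by rewrite ler_peMl ?mulr_ge0// ler1n.
Qed.

(** In the expansion of the variance, pairs sharing at most one element contribute
nothing, the diagonal contributes about the mean, and each overlapping pair
contributes at least half of its joint probability. *)
Lemma overlap_sum_le_variance i : (1 < c)%N ->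
    (forall a, tau a == i -> (1 < #|S a|)%N) ->
  overlap_sum i i <= 2 * (avg (fun phi => ((mono_number phi i)%:R - mean i) ^+ 2)
                       - mean i + mean i / c%:R).
Proof.
move=> c_gt1 Si.
have -> : avg (fun phi => ((mono_number phi i)%:R - mean i) ^+ 2) =
    \sum_(a | tau a == i) \sum_(b | tau b == i) (q a b - p a * p b).
  transitivity (avg (fun phi => \sum_(a | tau a == i) \sum_(b | tau b == i)
      ((mono phi (S a))%:R - p a) * ((mono phi (S b))%:R - p b))).
    apply: eq_avg => phi; rewrite ffunE natr_sum /mean -sumrB expr2.
    by rewrite big_distrlr.
  rewrite avg_sum; apply: eq_bigr => a _; rewrite avg_sum; apply: eq_bigr => b _.
  under eq_avg => phi do rewrite mulrBl !mulrBr.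
  rewrite !avgB avgZ avg_cst// (@avg_mono R T c c_gt0).
  under [X in _ - X - _]eq_avg => phi do rewrite mulrC.
  by rewrite avgZ avg_mono// [p b * _]mulrC subrr subr0.
rewrite /overlap_sum -ler_pdivrMl// /mean mulr_suml -sumrB -big_split mulr_sumr /=.
apply: ler_sum => a /[dup] ai /Si Sa.
rewrite [X in _ <= X - _ + _](bigD1 a)//= joint_probxx.
rewrite [X in _ <= _ + X - _ + _](bigID (overlap a)) /=.
rewrite [X in _ <= _ + (_ + X) - _ + _]big1 ?addr0 => [|b /andP[_]]; last first.
  by rewrite -leqNgt => /joint_prob_indep->//; rewrite subrr.
have pa : p a * p a <= p a / c%:R by rewrite ler_pM2l// mono_prob_le.
set s := \sum_(i0 | _) (_ - _).
suff : 2^-1 * (\sum_(b | [&& tau b == i, b != a & overlap a b]) q a b) <= s by lra.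
rewrite mulr_sumr /s (eq_bigl _ _ (fun b => andbA (tau b == i) (b != a) (overlap a b))).
apply: ler_sum => b /andP[_ ab]; have := overlap_mul_le ab.
have : 2 * (p a * p b) <= c%:R * (p a * p b).
  by rewrite ler_pM2r ?mulr_gt0// ler_nat.
by lra.
Qed.

Definition degree (i : 'I_d) (J : {set T}) : R :=
  \sum_(a | (tau a == i) && (J \subset S a)) p a.

(** The factor [c ^ (#|J| - 1)] is the one of [joint_prob_meet] for two sets with
intersection [J]; so expanding the square gives joint probabilities of pairs
that share [J]. *)
Definition degree_energy (i : 'I_d) (s : nat) : R :=
  \sum_(J : {set T} | (1 < #|J| < s)%N) c%:R ^+ #|J|.-1 * degree i J ^+ 2.

Lemma degree_mul_sum i j s :
  \sum_(J : {set T} | (1 < #|J| < s)%N)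
     c%:R ^+ #|J|.-1 * (degree i J * degree j J) =
  \sum_(a | tau a == i) \sum_(b | tau b == j)
    \sum_(J : {set T} | (1 < #|J| < s)%N && (J \subset S a :&: S b))
       c%:R ^+ #|J|.-1 * (p a * p b).
Proof.
under eq_bigr => J _.
  rewrite /degree big_distrlr mulr_sumr /=.
  under eq_bigr => a _ do rewrite mulr_sumr.
  over.
rewrite (exchange_big_dep (fun a => tau a == i)) /=; last by move=> J a _ /andP[].
apply: eq_bigr => a ai.
rewrite (exchange_big_dep (fun b => tau b == j)) /=; last by move=> J b _ /andP[].
apply: eq_bigr => b bj; apply: eq_bigl => J.
by rewrite finset.subsetI ai bj /= andbA.
Qed.

(** Group the overlapping pairs according to their intersection [J], which has
fewer than [s] elements, and apply Cauchy-Schwarz to the sum over [J]. *)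
Lemma overlap_sum_le_energy i j s :
    (forall a b, tau a = i -> tau b = j -> b != a -> overlap a b ->
       (#|S a :&: S b| < s)%N) ->
  overlap_sum i j ^+ 2 <= degree_energy i s * degree_energy j s.
Proof.
move=> small.
apply: le_trans (weighted_cauchy_schwarz _ _ _); last by move=> J _; exact: exprn_ge0.
rewrite lerXn2r ?nnegrE//; first by do 2 apply: sumr_ge0 => ? _.
  by apply: sumr_ge0 => J _; rewrite !mulr_ge0 ?exprn_ge0 ?sumr_ge0.
rewrite degree_mul_sum; apply: ler_sum => a /eqP ai.
have pw_ge0 b J : 0 <= c%:R ^+ #|J : {set T}|.-1 * (p a * p b).
  by rewrite mulr_ge0 ?exprn_ge0 ?mulr_ge0.
rewrite big_mkcondr; apply: ler_sum => b /eqP bj.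
case: ifP => [/andP[ba ab]|_]; last by apply: sumr_ge0.
rewrite (bigD1 (S a :&: S b))/=; last by rewrite small// subxx !andbT.
rewrite joint_prob_meet ?(ltnW ab)// mulrC lerDl.
by apply: sumr_ge0.
Qed.

(** Off the diagonal, a pair [(a, b)] is counted once for each set [J] inside the
intersection, that is at most [2 ^ e] times.  On the diagonal, [r] compares
[c ^ (#|J| - 1)] with [c ^ (e - 1) = 1 / p a]: one may take [r = 1], and even
[r = 1 / c] when [s <= e], since then [#|J| < e].  This gain is what makes the
overlaps between different types vanish. *)
Lemma degree_energy_le i e s (r : R) : (forall a, tau a == i -> #|S a| = e) ->
    (forall k, (k < s)%N -> (k <= e)%N -> c%:R ^+ k.-1 <= r * c%:R ^+ e.-1) ->
    0 <= r ->
  degree_energy i s <= 2 ^+ e * (r * mean i + overlap_sum i i).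
Proof.
move=> Se sr r_ge0.
rewrite /degree_energy; under eq_bigr => J _ do rewrite expr2.
rewrite degree_mul_sum /mean mulr_sumr -big_split mulr_sumr /=.
apply: ler_sum => a ai.
rewrite (bigD1 a)//= mulrDr.
have pw_ge0 b J : 0 <= c%:R ^+ #|J : {set T}|.-1 * (p a * p b).
  by rewrite mulr_ge0 ?exprn_ge0 ?mulr_ge0.
have card_sub (D : {set T}) : D \subset S a ->
    \sum_(J : {set T} | (1 < #|J| < s)%N && (J \subset D)) 1 <= 2 ^+ e :> R.
  move=> Da; rewrite -(natr_sum _ _ _ (fun=> 1%N)) -natrX ler_nat.
  rewrite sum1_card -(Se _ ai).
  rewrite -card_powerset subset_leq_card//; apply/fintype.subsetP => J.
  by move=> /andP[_ JD]; rewrite inE (fintype.subset_trans JD Da).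
apply: lerD.
  rewrite finset.setIid; apply: (@le_trans _ _
    (\sum_(J : {set T} | (1 < #|J| < s)%N && (J \subset S a)) 1 * (r * p a))).
    apply: ler_sum => J /andP[/andP[J1 Js] Ja]; rewrite mul1r.
    apply: (@le_trans _ _ (r * c%:R ^+ e.-1 * (p a * p a))).
      rewrite ler_pM2r ?mulr_gt0// sr// -(Se _ ai).
      exact: subset_leq_card.
    by rewrite /mono_prob Se// -mulrA mulVKf// expf_neq0// gt_eqF.
  by rewrite -mulr_suml ler_wpM2r ?mulr_ge0// card_sub.
rewrite mulr_sumr (bigID (overlap a)) /=.
rewrite [X in _ + X]big1 ?addr0 => [|b /andP[_ ab]]; last first.
  rewrite big1// => J /andP[/andP[J1 _] Jab]; case/negP: ab.
  by rewrite /overlap (leq_trans J1)// subset_leq_card.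
rewrite -(eq_bigl _ _ (fun b => esym (andbA (tau b == i) (b != a) (overlap a b)))).
apply: ler_sum => b /andP[_ ab].
apply: (@le_trans _ _
  (\sum_(J : {set T} | (1 < #|J| < s)%N && (J \subset S a :&: S b)) 1 * q a b)).
  apply: ler_sum => J /andP[/andP[J1 Js] Jab]; rewrite mul1r.
  rewrite joint_prob_meet ?(ltnW ab)// [leRHS]mulrC ler_pM2r ?mulr_gt0//.
  rewrite ler_weXn2l ?ler1n// -!subn1 leq_sub2r// subset_leq_card//.
by rewrite -mulr_suml ler_wpM2r// card_sub// finset.subsetIl.
Qed.


Definition element_degree (y : T) : R := \sum_(a | y \in S a) p a.

Definition pair_degree (y z : T) : R :=
  \sum_(a | (y \in S a) && (z \in S a)) p a.

Definition total_overlap : R :=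
  \sum_a \sum_(b | (b != a) && overlap a b) q a b.

Definition total_mean : R := \sum_a p a.

Lemma total_meanE : total_mean = \sum_i mean i.
Proof. by rewrite /total_mean (partition_big tau predT). Qed.

Lemma total_overlapE : total_overlap = \sum_i \sum_j overlap_sum i j.
Proof.
rewrite /total_overlap (partition_big tau predT)//=; apply: eq_bigr => i _.
rewrite /overlap_sum exchange_big /=; apply: eq_bigr => a _.
rewrite (partition_big tau predT)//=; apply: eq_bigr => j _.
by apply: eq_bigl => b; rewrite andbC.
Qed.

Lemma element_degree_ge0 y : 0 <= element_degree y.
Proof. exact: sumr_ge0. Qed.

Lemma pair_degree_ge0 y z : 0 <= pair_degree y z.
Proof. exact: sumr_ge0. Qed.

Lemma total_mean_ge0 : 0 <= total_mean.
Proof. exact: sumr_ge0. Qed.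

Lemma total_overlap_ge0 : 0 <= total_overlap.
Proof. by do 2 apply: sumr_ge0 => ? _. Qed.

Section Bounded.
Variable K : nat.
Hypothesis S_gt1 : forall a, (1 < #|S a|)%N.
Hypothesis S_leK : forall a, (#|S a| <= K)%N.

Lemma sum_element_degree_le : \sum_y element_degree y <= K%:R * total_mean.
Proof.
rewrite (exchange_big_dep predT)//= mulr_sumr; apply: ler_sum => a _.
by rewrite sumr_const -[p a *+ _]mulr_natl ler_pM2r// ler_nat.
Qed.

(** Expanding the square gives pairs of members with two common elements, of which
there are at most [K ^ 2] for each pair. *)
Lemma sum_pair_degree_le :
  \sum_(yz : T * T | yz.1 != yz.2) pair_degree yz.1 yz.2 ^+ 2 <=
  K%:R ^+ 2 * (total_mean / c%:R + total_overlap).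
Proof.
under eq_bigr => yz _ do rewrite expr2 /pair_degree big_distrlr /=.
rewrite (exchange_big_dep predT)//= /total_mean mulr_suml -big_split mulr_sumr.
apply: ler_sum => a _ /=; rewrite (exchange_big_dep predT)//=.
pose Y b := [set yz : T * T | (yz.1 != yz.2) &&
  ((yz.1 \in S a :&: S b) && (yz.2 \in S a :&: S b))].
have YE b : \sum_(yz : T * T | (yz.1 != yz.2) && ((yz.1 \in S a) && (yz.2 \in S a))
      && ((yz.1 \in S b) && (yz.2 \in S b))) p a * p b = #|Y b|%:R * (p a * p b).
  rewrite (eq_bigl (mem (Y b))) ?sumr_const ?mulr_natl// => yz.
  by rewrite !inE -!andbA; do !bool_congr.
have leY b : #|Y b|%:R <= K%:R ^+ 2 :> R.
  rewrite -natrX ler_nat (leq_trans (n := #|finset.setX (S a) (S a)|))//.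
    apply/subset_leq_card/fintype.subsetP => yz; rewrite !inE.
    by move=> /andP[_ /andP[/andP[-> _] /andP[-> _]]].
  by rewrite cardsX leq_mul.
rewrite (bigD1 a)//= YE mulrDr; apply: lerD.
  by rewrite ler_pM ?mulr_ge0// ler_pM2l// mono_prob_le.
rewrite (bigID (overlap a)) /= [X in _ + X]big1 ?addr0.
  rewrite mulr_sumr; apply: ler_sum => b /andP[_ ab]; rewrite YE.
  by rewrite ler_pM ?mulr_ge0// overlap_le.
move=> b /andP[_ ab]; rewrite YE (_ : #|Y b| = 0%N) ?mul0r//.
apply/eqP; rewrite cards_eq0; apply: contraR ab => /finset.set0Pn[[y z]].
rewrite inE /= => /andP[yz /andP[ySab zSab]].
by apply/card_gt1P; exists y, z.
Qed.

(** The anchor of [S a] is the element that the Stein-Chen argument allows [S a] to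
share freely with other members. *)
Definition is_anchor (x : A -> T) : Prop := forall a,
  x a \in S a /\ {in S a, forall y, element_degree y <= element_degree (x a)}.

Lemma anchor_exists : exists x, is_anchor x.
Proof.
suff : forall a, exists y,
    y \in S a /\ {in S a, forall z, element_degree z <= element_degree y}.
  exact: fin_all_exists.
move=> a; have /card_gt0P[y0 y0a] := ltnW (S_gt1 a).
case: (arg_maxP element_degree y0a) => y ya ymax.
by exists y; split.
Qed.

(** The degree of an element [y] other than the anchor [x a] is the minimum of the
degrees of [y] and [x a], so the sum is at most the sum of
[pair_degree y z * min (degree y) (degree z)] over pairs of distinct elements.
Apply Cauchy-Schwarz, with [min u v ^ 2 <= u * v]. *)
Lemma anchored_degree_sum_le x : is_anchor x ->
  \sum_a \sum_(y in S a :\ x a) p a * element_degree y <=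
  Num.sqrt (K%:R ^+ 2 * (total_mean / c%:R + total_overlap))
    * (K%:R * total_mean).
Proof.
move=> anchx; pose m y z := Num.min (element_degree y) (element_degree z).
have m_ge0 y z : 0 <= m y z by rewrite le_min !element_degree_ge0.
pose M := \sum_(yz : T * T | yz.1 != yz.2) pair_degree yz.1 yz.2 * m yz.1 yz.2.
apply: (@le_trans _ _ M).
  rewrite /M; under [leRHS]eq_bigr => yz _ do rewrite mulr_suml.
  rewrite [leRHS](exchange_big_dep predT)//=; apply: ler_sum => a _.
  rewrite -(pair_big_dep predT (fun y z => (y != z) && ((y \in S a) && (z \in S a)))
    (fun y z => p a * m y z)) /= big_mkcond; apply: ler_sum => y _.
  case: ifP => [|_]; last by apply: sumr_ge0 => z _; rewrite mulr_ge0.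
  rewrite finset.in_setD1 => /andP[yx ya]; have [xa xmax] := anchx a.
  rewrite (bigD1 (x a)) ?yx ?ya//= {1}/m (min_idPl _) ?xmax// lerDl.
  by apply: sumr_ge0 => z _; rewrite mulr_ge0.
have M_ge0 : 0 <= M.
  by apply: sumr_ge0 => yz _; rewrite mulr_ge0 ?pair_degree_ge0.
have KL_ge0 : 0 <= K%:R * total_mean by rewrite mulr_ge0 ?total_mean_ge0.
have D_ge0 : 0 <= \sum_y element_degree y.
  by apply: sumr_ge0 => y _; exact: element_degree_ge0.
have E_ge0 : 0 <= K%:R ^+ 2 * (total_mean / c%:R + total_overlap).
  by rewrite mulr_ge0 ?exprn_ge0// addr_ge0 ?divr_ge0 ?total_mean_ge0 ?total_overlap_ge0.
rewrite -(ger0_norm M_ge0) -sqrtr_sqr -(ger0_norm KL_ge0) -sqrtr_sqr -sqrtrM//.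
rewrite ler_wsqrtr//.
have := @weighted_cauchy_schwarz R _ (fun yz : T * T => yz.1 != yz.2) (fun=> 1)
  (fun yz => pair_degree yz.1 yz.2) (fun yz => m yz.1 yz.2) (fun _ _ => ler01).
under eq_bigr do rewrite mul1r.
under [in X in _ <= X]eq_bigr do rewrite mul1r.
under [in X in _ * X]eq_bigr do rewrite mul1r.
move=> /le_trans; apply; apply: ler_pM.
- by apply: sumr_ge0 => yz _; rewrite exprn_ge0 ?pair_degree_ge0.
- by apply: sumr_ge0 => yz _; rewrite exprn_ge0.
- exact: sum_pair_degree_le.
apply: (@le_trans _ _ ((\sum_y element_degree y) ^+ 2)); last first.
  by rewrite lerXn2r ?nnegrE// sum_element_degree_le.
rewrite expr2 big_distrlr pair_big/= [leRHS](bigID (fun yz : T * T => yz.1 != yz.2)) /=.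
rewrite -[leLHS]addr0 lerD//; last first.
  by apply: sumr_ge0 => yz _; rewrite mulr_ge0 ?element_degree_ge0.
apply: ler_sum => yz _; rewrite expr2.
by rewrite ler_pM// /m ge_min lexx ?orbT.
Qed.

Definition increment (i : 'I_d) (y : {ffun 'I_d -> nat}) : {ffun 'I_d -> nat} :=
  [ffun j => y j + (j == i)]%N.

Section SteinChen.
Variable x : A -> T.
Hypothesis x_anchor : is_anchor x.

(** Members that meet [S a] outside its anchor. *)
Definition linked a b := (b != a) && ~~ (S a :&: S b \subset [set x a]).

Definition unlinked_number a (phi : coloring) : {ffun 'I_d -> nat} :=
  [ffun j => \sum_(b | (tau b == j) && (b != a) && ~~ linked a b) mono phi (S b)]%N.

Definition linked_number a (phi : coloring) : nat :=
  \sum_(b | linked a b) mono phi (S b).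

(** The Stein-Chen error. *)
Definition linked_sum : R :=
  \sum_a (p a ^+ 2 + \sum_(b | linked a b) (q a b + p a * p b)).

(** When no linked member is monochromatic, the counts are determined by the
unlinked members and [S a] itself. *)
Lemma mono_number_unlinked a phi : linked_number a phi = 0%N ->
  mono_number phi = if mono phi (S a) then increment (tau a) (unlinked_number a phi)
                    else unlinked_number a phi.
Proof.
move=> /eqP; rewrite sum_nat_eq0 => /forall_inP na.
suff E j : mono_number phi j =
    (unlinked_number a phi j + mono phi (S a) * (j == tau a))%N.
  by apply/ffunP => j; rewrite E; case: (mono phi (S a));
     rewrite ?mul0n ?mul1n ?addn0 // !ffunE.
rewrite !ffunE.
have F : (\sum_(b | (tau b == j) && (b != a)) mono phi (S b) =
    \sum_(b | (tau b == j) && (b != a) && ~~ linked a b) mono phi (S b))%N.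
  rewrite (bigID (linked a)) /= big1 ?add0n// => b /andP[_ /na/eqP//].
rewrite -F [j == _]eq_sym; have [aj|aj] := boolP (tau a == j).
  by rewrite (bigD1 a)//= addnC muln1.
rewrite muln0 addn0; apply: eq_bigl => b.
by case: eqP => //= bj; apply/esym; apply: contraNneq aj => <-; apply/eqP.
Qed.

(** For each [a] of type [i], replace the counts by those of the unlinked members,
which by [avg_mono_indep] are independent of whether [S a] is monochromatic.  The
replacement is exact unless a linked member is monochromatic; this costs [q a b]
on the event that [S a] is monochromatic, and [p a * (p a + p b)] when the counts are
put back after factoring out [p a]. *)
Lemma stein_chen i (g : {ffun 'I_d -> nat} -> R) : (forall y, 0 <= g y <= 1) ->
  `|avg (fun phi => (mono_number phi i)%:R * g (mono_number phi)) -
    mean i * avg (fun phi => g (increment i (mono_number phi)))| <= linked_sum.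
Proof.
move=> g01.
have dg y z : `|g y - g z| <= 1.
  by have := g01 y; have := g01 z; rewrite ler_norml; lra.
have -> : avg (fun phi => (mono_number phi i)%:R * g (mono_number phi)) =
    \sum_(a | tau a == i) avg (fun phi => (mono phi (S a))%:R * g (mono_number phi)).
  rewrite -avg_sum; apply: eq_avg => phi; rewrite ffunE natr_sum mulr_suml.
  by [].
rewrite /mean mulr_suml -sumrB (le_trans (ler_norm_sum _ _ _))// /linked_sum.
rewrite [leRHS](bigID (fun a => tau a == i)) /= -[leLHS]addr0 lerD//; last first.
  apply: sumr_ge0 => a _; rewrite addr_ge0 ?exprn_ge0 ?sumr_ge0// => b _.
  by rewrite addr_ge0// mulr_ge0.
apply: ler_sum => a /eqP <-{i}.
pose U phi := g (increment (tau a) (unlinked_number a phi)).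
have avgU : avg (fun phi => (mono phi (S a))%:R * U phi) = p a * avg U.
  have [xa _] := x_anchor a.
  apply: (avg_mono_indep _ xa) => // phi psi agr; rewrite /U; congr (g (increment _ _)).
  apply/ffunP => j; rewrite !ffunE; apply: eq_bigr => b /andP[/andP[_ ba]].
  rewrite /linked ba /= negbK => /fintype.subsetP Sab; congr nat_of_bool.
  have eqb e : e \in S b -> phi e = psi e.
    move=> eb; apply: agr; rewrite !inE negb_and negbK; case: eqP => //= ex.
    by apply/negP => ea; apply: ex; apply/finset.set1P/Sab; rewrite inE ea.
  by apply/monoP/monoP => mD e e' eD e'D; [rewrite -!eqb|rewrite !eqb] => //; apply: mD.
rewrite (_ : _ - _ = avg (fun phi => (mono phi (S a))%:R * (g (mono_number phi) - U phi))
   + p a * avg (fun phi => U phi - g (increment (tau a) (mono_number phi)))); last first.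
  under [X in _ = X + _]eq_avg do rewrite mulrBr.
  by rewrite !avgB avgU mulrBr addrA subrK.
have first_le : `|avg (fun phi => (mono phi (S a))%:R * (g (mono_number phi) - U phi))|
    <= \sum_(b | linked a b) q a b.
  rewrite (le_trans (ler_norm_avg _ _))//.
  rewrite /joint_prob -avg_sum; apply: le_avg => // phi.
  rewrite normrM -mulr_sumr ger0_norm//.
  rewrite -natr_sum -/(linked_number a phi).
  case: (posnP (linked_number a phi)) => [l0|l_gt0].
    rewrite (mono_number_unlinked l0) /U; case: mono; rewrite ?mul1r ?mul0r//.
    by rewrite subrr normr0.
  by rewrite ler_wpM2l// (le_trans (dg _ _))// ler1n.
have second_le : `|avg (fun phi => U phi - g (increment (tau a) (mono_number phi)))|
    <= p a + \sum_(b | linked a b) p b.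
  rewrite (le_trans (ler_norm_avg _ _))//.
  rewrite -(avg_mono R c_gt0 (S a)).
  under eq_bigr do rewrite -avg_mono//.
  rewrite -avg_sum -avgD; apply: le_avg => // phi.
  rewrite -natr_sum -/(linked_number a phi).
  case: (posnP (linked_number a phi)) => [l0|l_gt0].
    rewrite (mono_number_unlinked l0) l0 addr0.
    by case: mono; rewrite ?dg// /U subrr normr0.
  by rewrite (le_trans (dg _ _))// -natrD ler1n addn_gt0 l_gt0 orbT.
rewrite (le_trans (ler_normD _ _))// big_split /= -mulr_sumr addrCA lerD//.
by rewrite normrM ger0_norm// expr2 -mulrDr ler_wpM2l.
Qed.

(** A linked [b] either overlaps [a], and is paid by [total_overlap], or meets [S a]
in a single element [y] which is not its anchor.  In the latter case the two are
independent and [p a * p b] is part of [p a * element_degree y]. *)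
Lemma linked_sum_le :
  linked_sum <= total_mean / c%:R + 2 * total_overlap +
    2 * (Num.sqrt (K%:R ^+ 2 * (total_mean / c%:R + total_overlap))
         * (K%:R * total_mean)).
Proof.
apply: (@le_trans _ _ (total_mean / c%:R + 2 * total_overlap +
    2 * \sum_a \sum_(y in S a :\ x a) p a * element_degree y)); last first.
  by rewrite lerD2l ler_pM2l// anchored_degree_sum_le.
rewrite /total_mean mulr_suml /total_overlap !mulr_sumr -!big_split /=.
apply: ler_sum => a _; rewrite -addrA; apply: lerD.
  by rewrite expr2 ler_pM2l// mono_prob_le.
under [X in _ <= _ + 2 * X]eq_bigr do rewrite /element_degree mulr_sumr.
rewrite (exchange_big_dep predT)//=.
rewrite mulr_sumr [X in _ <= X + _]big_mkcond mulr_sumr -big_split /=.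
rewrite big_mkcond; apply: ler_sum => b _ /=.
have Y_ge0 : 0 <= \sum_(y | (y \in S a :\ x a) && (y \in S b)) p a * p b.
  by apply: sumr_ge0 => y _; rewrite mulr_ge0.
case: ifPn => [/andP[ba /subsetPn[y]]|_]; last first.
  by apply: addr_ge0; [case: ifP => // _|]; apply: mulr_ge0.
rewrite !inE ba /= => /andP[ya yb] yx.
case: ifPn => [ab|].
  have := overlap_le ab; lra.
rewrite -leqNgt => ab; rewrite add0r (joint_prob_indep R c_gt0 ab).
rewrite (bigD1 y) /=; last by rewrite !inE yx ya yb.
set rest := \sum_(z | _) _; suff : 0 <= rest by lra.
by apply: sumr_ge0 => z _; rewrite mulr_ge0.
Qed.

End SteinChen.
End Bounded.
End Family.

(** * Poisson limits from an approximate recursion *)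

Local Open Scope classical_set_scope.
Local Open Scope ring_scope.

(** Sums over all vectors with coordinates below [M] are written as sums over the
finite type of functions into ['I_M]. *)
Definition box_point d M (x : {ffun 'I_d -> 'I_M}) : {ffun 'I_d -> nat} :=
  [ffun i => x i : nat].

Definition in_box d (M : nat) (y : {ffun 'I_d -> nat}) : bool :=
  [forall i, (y i < M)%N].

Lemma sum_box (R : pzSemiRingType) d M (y : {ffun 'I_d -> nat})
    (h : {ffun 'I_d -> nat} -> R) :
  \sum_(x : {ffun 'I_d -> 'I_M}) h (box_point x) * (y == box_point x)%:R =
  h y * (in_box M y)%:R.
Proof.
have [/forallP yM|yM] := boolP (in_box M y); last first.
  rewrite mulr0 big1// => x _; case: eqP => [yx|]; last by rewrite mulr0.
  by case/negP: yM; apply/forallP => i; rewrite yx ffunE.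
pose x0 : {ffun 'I_d -> 'I_M} := [ffun i => Ordinal (yM i)].
have yx0 : y = box_point x0 by apply/ffunP => i; rewrite !ffunE.
rewrite (bigD1 x0)//= -yx0 eqxx big1 ?addr0// => x xx0.
case: eqP => [yx|]; last by rewrite mulr0.
case/eqP: xx0; apply/ffunP => i; apply: val_inj.
by move/ffunP/(_ i): yx; rewrite yx0 !ffunE.
Qed.

Lemma point_mass_le1 (R : numDomainType) d (u : {ffun 'I_d -> nat} -> R) y :
    (forall z, 0 <= u z) ->
    (forall M, \sum_(x : {ffun 'I_d -> 'I_M}) u (box_point x) <= 1) ->
  u y <= 1.
Proof.
move=> u_ge0 u_box_le1.
have yM : in_box (\sum_i y i).+1 y.
  by apply/forallP => i; rewrite ltnS (bigD1 i)//= leq_addr.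
apply: le_trans (u_box_le1 (\sum_i y i).+1).
have := sum_box (\sum_i y i).+1 y u; rewrite yM mulr1 => <-.
by apply: ler_sum => x _; rewrite -[leRHS]mulr1 ler_wpM2l// lern1 leq_b1.
Qed.

Lemma increment_ind d (Q : {ffun 'I_d -> nat} -> Prop) :
  Q [ffun=> 0%N] -> (forall i y, Q y -> Q (increment i y)) -> forall y, Q y.
Proof.
move=> Q0 QS y; have [k] := ubnP (\sum_i y i)%N.
elim: k y => // k IH y; rewrite ltnS => yk.
have [/forallP y0|] := boolP [forall i, y i == 0%N].
  by rewrite (_ : y = [ffun=> 0%N])//; apply/ffunP => i; rewrite ffunE; apply/eqP.
rewrite negb_forall => /existsP[i yi].
pose z : {ffun 'I_d -> nat} := [ffun j => y j - (j == i)]%N.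
have yz : y = increment i z.
  apply/ffunP => j; rewrite !ffunE subnK//.
  by case: eqP => // ->; rewrite lt0n.
rewrite yz; apply/QS/IH; rewrite (leq_trans _ yk)//.
rewrite (bigD1 i)//= [ltnRHS](bigD1 i)//= -addSn ffunE eqxx subn1 prednK ?lt0n//.
by rewrite leq_add2l leq_sum// => j _; rewrite ffunE leq_subr.
Qed.

Lemma cvgr_sum (R : realType) (I : finType) (T : Type) (F : set_system T)
    {FF : Filter F} (f : I -> T -> R) (l : I -> R) :
  (forall i, f i x @[x --> F] --> l i) ->
  \sum_i f i x @[x --> F] --> \sum_i l i.
Proof.
by move=> fl; apply: cvg_big => [|i _]; [exact: add_continuous|exact: fl].
Qed.

Lemma cvgr_sum0 (R : realType) (I : finType) (T : Type) (F : set_system T)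
    {FF : Filter F} (f : I -> T -> R) :
  (forall i, f i x @[x --> F] --> (0 : R)) ->
  \sum_i f i x @[x --> F] --> (0 : R).
Proof. by move=> /cvgr_sum; rewrite [X in _ --> X]big1. Qed.

(** In this section [q] is the limit law, [a n] a sequence of laws with means [m n]. *)
Section PoissonLimit.
Variables (R : realType) (d : nat) (lambda : 'I_d -> R).
Variables (a : nat -> {ffun 'I_d -> nat} -> R) (m : nat -> 'I_d -> R).
Variable q : {ffun 'I_d -> nat} -> R.
Local Notation box_mass u M :=
  (\sum_(x : {ffun 'I_d -> 'I_M}) u (box_point x)).
Hypothesis a_rec : forall i (y : {ffun 'I_d -> nat}),
  (y i).+1%:R * a n (increment i y) - m n i * a n y @[n --> \oo] --> (0 : R).
Hypothesis m_cvg : forall i, m n i @[n --> \oo] --> lambda i.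
Hypothesis a_ge0 : forall n y, 0 <= a n y.
Hypothesis a_box_le1 : forall n M, box_mass (a n) M <= 1.
Hypothesis a_tight : forall n M, (0 < M)%N ->
  1 - box_mass (a n) M <= (\sum_i m n i) / M%:R.
Hypothesis q_rec : forall i (y : {ffun 'I_d -> nat}),
  (y i).+1%:R * q (increment i y) = lambda i * q y.
Hypothesis q_ge0 : forall y, 0 <= q y.
Hypothesis q_box_le1 : forall M, box_mass q M <= 1.
Hypothesis q_tight : box_mass q M @[M --> \oo] --> (1 : R).

Local Notation zero := ([ffun=> 0%N] : {ffun 'I_d -> nat}).

Let a_le1 n y : a n y <= 1.
Proof. exact: point_mass_le1. Qed.

(** The recursions for [a n] and [q] have asymptotically the same coefficients, so
proportionality passes from [y] to [increment i y].  The form without quotients covers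
points of mass 0, which occur when some [lambda i = 0]. *)
Lemma proportional_cvg y :
  q zero * a n y - q y * a n zero @[n --> \oo] --> (0 : R).
Proof.
elim/increment_ind: y => [|i y IH].
  by under eq_fun do rewrite subrr; exact: cvg_cst.
have S_neq0 : (y i).+1%:R != 0 :> R by rewrite pnatr_eq0.
rewrite (_ : (fun n => _) = fun n => (y i).+1%:R^-1 *
  (q zero * ((y i).+1%:R * a n (increment i y) - m n i * a n y) +
   q zero * ((m n i - lambda i) * a n y) +
   lambda i * (q zero * a n y - q y * a n zero))); last first.
  apply/funext => n; apply: (mulfI S_neq0).
  rewrite mulVKf// mulrBr [_ * (q _ * a n zero)]mulrA q_rec; ring.
rewrite -[X in _ --> X](_ : (y i).+1%:R^-1 * (q zero * 0 + q zero * 0 + lambda i * 0) = 0);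
  last by rewrite !mulr0 !addr0 mulr0.
apply: cvgMl_tmp; apply: cvgD; [apply: cvgD|]; apply: cvgMl_tmp => //.
have mlam : `|m n i - lambda i| @[n --> \oo] --> (0 : R).
  rewrite -[X in _ --> X](normr0 R) -(subrr (lambda i)).
  by apply: cvg_norm; apply: cvgB => //; exact: cvg_cst.
apply/norm_cvg0P; apply: squeeze_cvgr mlam; last exact: cvg_cst.
by apply: nearW => n; rewrite normr_ge0 normrM ler_piMr// ger0_norm.
Qed.

Lemma box_mass_cvg_sum M : (forall y, a n y @[n --> \oo] --> q y) ->
  box_mass (a n) M @[n --> \oo] --> box_mass q M.
Proof. by move=> aq; apply: cvgr_sum => x. Qed.

Let q_le1 y : q y <= 1.
Proof. exact: point_mass_le1. Qed.

(** The masses of [a n] and [q] in a large box are both nearly 1, and they are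
asymptotically proportional, so the constant of proportionality is 1. *)
Lemma point_mass0_cvg : a n zero @[n --> \oo] --> q zero.
Proof.
apply/cvgrPdist_lt => eps eps_gt0.
have eps3 : 0 < eps / 3 by rewrite divr_gt0.
pose C := \sum_i lambda i + 1.
have mC : \forall n \near \oo, \sum_i m n i <= C.
  apply: (cvgr_le (\sum_i lambda i)); first exact: cvgr_sum.
  by rewrite /C ltrDl.
have [M [M_gt0 qM CM]] : exists M, [/\ (0 < M)%N, 1 - box_mass q M < eps / 3 &
    C / M%:R < eps / 3].
  have q_near : \forall M \near \oo, 1 - box_mass q M < eps / 3.
    have /cvgrPdist_lt/(_ _ eps3) := q_tight; apply: filterS => M.
    exact/le_lt_trans/ler_norm.
  have C_near : \forall M \near \oo, C / M%:R < eps / 3.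
    near=> M; have M0 : 0 < M%:R :> R by rewrite ltr0n; near: M; exact: nbhs_infty_gt.
    rewrite ltr_pdivrMr// -ltr_pdivrMl//.
    by near: M; exact: nbhs_infty_gtr.
  near \oo => M; exists M; split; near: M; [|exact: q_near|exact: C_near].
  exact: nbhs_infty_gt.
pose D n := q zero * box_mass (a n) M - a n zero * box_mass q M.
(* D compares the box masses of the two laws, each normalized at 0. *)
have D_cvg : D n @[n --> \oo] --> (0 : R).
  rewrite (_ : D = fun n => \sum_(x : {ffun 'I_d -> 'I_M})
      (q zero * a n (box_point x) - q (box_point x) * a n zero)); last first.
    by apply/funext => n; rewrite sumrB /D mulr_sumr [_ * box_mass q M]mulrC mulr_suml.
  by apply: cvgr_sum0 => x; exact: proportional_cvg.
have Dlt : \forall n \near \oo, `|D n| < eps / 3 by exact: cvgr0_norm_lt.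
near=> n.
have -> : q zero - a n zero =
    q zero * (1 - box_mass (a n) M) - a n zero * (1 - box_mass q M) + D n.
  by rewrite /D; ring.
have Dn : `|D n| < eps / 3 by near: n.
have mn : \sum_i m n i <= C by near: n.
have aM : q zero * (1 - box_mass (a n) M) < eps / 3.
  apply: (@le_lt_trans _ _ (1 - box_mass (a n) M)).
    by rewrite ler_piMl// subr_ge0.
  apply: le_lt_trans CM; rewrite (le_trans (a_tight _ _))//.
  by rewrite ler_pM2r// invr_gt0 ltr0n.
have aM0 : 0 <= q zero * (1 - box_mass (a n) M) by rewrite mulr_ge0// subr_ge0.
have qM' : a n zero * (1 - box_mass q M) < eps / 3.
  by apply: le_lt_trans qM; rewrite ler_piMl// subr_ge0.
have qM0 : 0 <= a n zero * (1 - box_mass q M) by rewrite mulr_ge0// subr_ge0.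
move: Dn; rewrite ltr_norml => /andP[]; rewrite ltr_norml; lra.
Unshelve. all: by end_near.
Qed.

Lemma q_zero_neq0 : q zero != 0.
Proof.
apply/eqP => q0; have q_eq0 y : q y = 0.
  elim/increment_ind: y => // i y IH; have := q_rec i y; rewrite IH mulr0.
  by move/eqP; rewrite mulf_eq0 pnatr_eq0 => /eqP.
have : box_mass q M @[M --> \oo] --> (0 : R).
  by under eq_fun do rewrite big1//; exact: cvg_cst.
move=> /(cvg_unique _ q_tight) => /(_ (@norm_hausdorff _ _))/eqP.
by rewrite oner_eq0.
Qed.

Lemma point_mass_cvg y : a n y @[n --> \oo] --> q y.
Proof.
have q0 := q_zero_neq0.
rewrite (_ : (fun n => _) = fun n => (q zero)^-1 *
  (q zero * a n y - q y * a n zero + q y * a n zero)); last first.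
  by apply/funext => n; rewrite subrK mulKf.
rewrite -[X in _ --> X](_ : (q zero)^-1 * (0 + q y * q zero) = q y); last first.
  by rewrite add0r mulrC mulfK.
apply: cvgMl_tmp; apply: cvgD; first exact: proportional_cvg.
by apply: cvgMl_tmp; exact: point_mass0_cvg.
Qed.

(** The hypotheses say that [Ea n] and [Eq] behave as the expectations of a function
bounded by [B]; they make the lemma applicable to averages over colorings and to
integrals alike. *)
Lemma bounded_test_cvg (f : {ffun 'I_d -> nat} -> R) (B : R) (Ea : nat -> R) Eq :
    (forall n M, `|Ea n - box_mass (fun y => f y * a n y) M|
                   <= B * (1 - box_mass (a n) M)) ->
    (forall M, `|Eq - box_mass (fun y => f y * q y) M| <= B * (1 - box_mass q M)) ->
  Ea n @[n --> \oo] --> Eq.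
Proof.
move=> Ea_near Eq_near; apply/cvgrPdist_lt => eps eps_gt0.
have eps3 : 0 < eps / 3 by rewrite divr_gt0.
have tail_cvg : B * (1 - box_mass q M) @[M --> \oo] --> (0 : R).
  rewrite -[X in _ --> X](mulr0 B) -[X in _ * X](subrr (1 : R)).
  by apply: cvgMl_tmp; apply: cvgB => //; exact: cvg_cst.
have [M BqM] : exists M, `|B * (1 - box_mass q M)| < eps / 3.
  have : \forall M \near \oo, `|B * (1 - box_mass q M)| < eps / 3.
    exact: cvgr0_norm_lt.
  by move=> h; near \oo => M; exists M; near: M.
have a_cvg := point_mass_cvg.
have BaM : \forall n \near \oo, B * (1 - box_mass (a n) M) < eps / 3.
  apply: (cvgr_lt (B * (1 - box_mass q M))).
    apply: cvgMl_tmp; apply: cvgB; [exact: cvg_cst|exact: box_mass_cvg_sum].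
  exact: le_lt_trans (ler_norm _) BqM.
have faM : \forall n \near \oo, `|box_mass (fun y => f y * q y) M -
    box_mass (fun y => f y * a n y) M| < eps / 3.
  apply: cvgr_dist_lt => //; apply: cvgr_sum => x.
  exact: cvgMl_tmp.
near=> n.
have BaMn : B * (1 - box_mass (a n) M) < eps / 3 by near: n.
have faMn : `|box_mass (fun y => f y * q y) M -
    box_mass (fun y => f y * a n y) M| < eps / 3 by near: n.
set u := \sum_x _ in faMn; set v := \sum_x _ in faMn.
have Eav : `|Ea n - v| < eps / 3 := le_lt_trans (Ea_near n M) BaMn.
have Equ : `|Eq - u| < eps / 3.
  exact: le_lt_trans (Eq_near M) (le_lt_trans (ler_norm _) BqM).
move: faMn Eav Equ; rewrite !ltr_norml => /andP[? ?] /andP[? ?] /andP[? ?].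
by apply/andP; split; lra.
Unshelve. all: by end_near.
Qed.

End PoissonLimit.

(** * The Poisson limit for families of sets *)

Lemma increment_inj d (i : 'I_d) : injective (increment i).
Proof.
by move=> y z /ffunP yz; apply/ffunP => j; have := yz j; rewrite !ffunE => /addIn.
Qed.

Section MonoPoisson.
Variables (R : realType) (d : nat) (T A : nat -> finType) (c : nat -> nat) (K : nat).
Variables (S : forall n, A n -> {set T n}) (tau : forall n, A n -> 'I_d).
Variable lambda : 'I_d -> R.
Hypothesis c_gt0 : forall n, (0 < c n)%N.
Hypothesis c_cvg : c n @[n --> \oo] --> \oo.
Hypothesis S_card : \forall n \near \oo, forall a, (1 < #|S (n := n) a| <= K)%N.
Hypothesis mean_cvg : forall i,
  mean R (c n) (@S n) (@tau n) i @[n --> \oo] --> lambda i.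
Hypothesis overlap_cvg : forall i j,
  overlap_sum R (c n) (@S n) (@tau n) i j @[n --> \oo] --> (0 : R).

Local Notation N n := (@mono_number (T n) (A n) (c n) d (@S n) (@tau n)).

Definition mono_law n (y : {ffun 'I_d -> nat}) : R :=
  avg (fun phi => (N n phi == y)%:R).

Lemma box_mono_law n M (f : {ffun 'I_d -> nat} -> R) :
  \sum_(x : {ffun 'I_d -> 'I_M}) f (box_point x) * mono_law n (box_point x) =
  avg (fun phi => f (N n phi) * (in_box M (N n phi))%:R).
Proof.
under [RHS]eq_avg do rewrite -sum_box.
by rewrite avg_sum; apply: eq_bigr => x _; rewrite avgZ.
Qed.

Lemma box_mono_law1 n M :
  \sum_(x : {ffun 'I_d -> 'I_M}) mono_law n (box_point x) =
  avg (fun phi => (in_box M (N n phi))%:R).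
Proof.
have := box_mono_law n M (fun=> 1); under eq_bigr do rewrite mul1r.
by move=> ->; under eq_avg do rewrite mul1r.
Qed.

(** Markov's inequality for the total number of monochromatic members. *)
Lemma mono_law_tight n M : (0 < M)%N ->
  1 - \sum_(x : {ffun 'I_d -> 'I_M}) mono_law n (box_point x) <=
  (\sum_i mean R (c n) (@S n) (@tau n) i) / M%:R.
Proof.
move=> M_gt0; rewrite box_mono_law1 -[X in X - _](avg_cst (T n) (c_gt0 n)) -avgB.
under eq_bigr do rewrite -avg_mono_number//.
rewrite mulrC -avg_sum -avgZ; apply: le_avg => // phi.
rewrite ler_pdivlMl ?ltr0n// -natr_sum.
have [|] := boolP (in_box _ _); first by rewrite subrr mulr0.
rewrite negb_forall => /existsP[i]; rewrite -leqNgt subr0 mulr1 ler_nat => Mi.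
by rewrite (leq_trans Mi)// (bigD1 i)//= leq_addr.
Qed.

Lemma invc_cvg : (c n)%:R^-1 @[n --> \oo] --> (0 : R).
Proof.
apply/gtr0_cvgV0; first by near=> n; rewrite ltr0n.
exact/cvgrnyP.
Unshelve. all: by end_near.
Qed.

Let Lam n := total_mean R (c n) (@S n).
Let H n := total_overlap R (c n) (@S n).

Lemma linked_bound_cvg : Lam n / (c n)%:R + 2 * H n +
    2 * (Num.sqrt (K%:R ^+ 2 * (Lam n / (c n)%:R + H n)) * (K%:R * Lam n))
  @[n --> \oo] --> (0 : R).
Proof.
have Lam_cvg : Lam n @[n --> \oo] --> \sum_i lambda i.
  rewrite /Lam; under eq_fun do rewrite (total_meanE _ _ _ (@tau _)).
  exact: cvgr_sum.
have H_cvg : H n @[n --> \oo] --> (0 : R).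
  rewrite /H; under eq_fun do rewrite (total_overlapE _ _ _ (@tau _)).
  by apply: cvgr_sum0 => i; apply: cvgr_sum0 => j; exact: overlap_cvg.
have Lc_cvg : Lam n / (c n)%:R @[n --> \oo] --> (0 : R).
  by rewrite -[X in _ --> X](mulr0 (\sum_i lambda i)); apply: cvgM => //; exact: invc_cvg.
rewrite -[X in _ --> X](_ : 0 + 2 * 0 + 2 *
  (Num.sqrt (K%:R ^+ 2 * (0 + 0)) * (K%:R * \sum_i lambda i)) = 0); last first.
  by rewrite !(mulr0, addr0, sqrtr0, mul0r).
apply: cvgD; first by apply: cvgD => //; exact: cvgMl_tmp.
apply: cvgMl_tmp; apply: cvgM; last exact: cvgMl_tmp.
apply: continuous_cvg; first exact: sqrt_continuous.
by apply: cvgMl_tmp; exact: cvgD.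
Qed.

(** Apply [stein_chen] to the indicator of the point [increment i y]. *)
Lemma mono_law_rec i (y : {ffun 'I_d -> nat}) :
  (y i).+1%:R * mono_law n (increment i y)
    - mean R (c n) (@S n) (@tau n) i * mono_law n y @[n --> \oo] --> (0 : R).
Proof.
apply/norm_cvg0P; apply: squeeze_cvgr (cvg_cst 0) linked_bound_cvg.
near=> n; rewrite normr_ge0 /=.
have Scard : forall a, (1 < #|S (n := n) a| <= K)%N by near: n.
have S_gt1 a : (1 < #|S (n := n) a|)%N by have /andP[] := Scard a.
have S_leK a : (#|S (n := n) a| <= K)%N by have /andP[] := Scard a.
have [x x_anchor] := anchor_exists R (c n) S_gt1.
apply: le_trans (linked_sum_le (c_gt0 n) S_gt1 S_leK x_anchor).
(* On the event g = 1 the i-th count equals (y i).+1. *)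
pose g (z : {ffun 'I_d -> nat}) : R := (z == increment i y)%:R.
have g01 z : 0 <= g z <= 1 by rewrite ler0n lern1 leq_b1.
have := stein_chen (@tau n) (c_gt0 n) x_anchor i g01.
congr (`| _ - _ * _| <= _).
  rewrite /mono_law -avgZ; apply: eq_avg => phi; rewrite /g.
  case: eqP => [->|_]; last by rewrite !mulr0.
  by rewrite ffunE eqxx addn1.
by apply: eq_avg => phi; rewrite /g (inj_eq (@increment_inj d i)).
Unshelve. all: by end_near.
Qed.

Variables (q : {ffun 'I_d -> nat} -> R) (f : {ffun 'I_d -> nat} -> R) (B Eq : R).
Hypothesis q_rec : forall i (y : {ffun 'I_d -> nat}),
  (y i).+1%:R * q (increment i y) = lambda i * q y.
Hypothesis q_ge0 : forall y, 0 <= q y.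
Hypothesis q_box_le1 : forall M,
  \sum_(x : {ffun 'I_d -> 'I_M}) q (box_point x) <= 1.
Hypothesis q_tight :
  \sum_(x : {ffun 'I_d -> 'I_M}) q (box_point x) @[M --> \oo] --> (1 : R).
Hypothesis f_le : forall y, `|f y| <= B.
Hypothesis Eq_box : forall M,
  `|Eq - \sum_(x : {ffun 'I_d -> 'I_M}) f (box_point x) * q (box_point x)| <=
  B * (1 - \sum_(x : {ffun 'I_d -> 'I_M}) q (box_point x)).

(** [q] stands for the product Poisson law, [Eq] for the expectation of [f] under
it. *)
Theorem mono_number_cvg : avg (fun phi => f (N n phi)) @[n --> \oo] --> Eq.
Proof.
apply: (bounded_test_cvg mono_law_rec mean_cvg _ _ mono_law_tight q_rec q_ge0
  q_box_le1 q_tight _ Eq_box).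
- by move=> n y; apply: avg_ge0.
- move=> n M; rewrite box_mono_law1 -[leRHS](avg_cst (T n) (c_gt0 n)).
  by apply: le_avg => // phi; rewrite lern1 leq_b1.
move=> n M; rewrite box_mono_law box_mono_law1.
rewrite -[X in _ * (X - _)](avg_cst (T n) (c_gt0 n)) -!avgB -avgZ.
apply: le_trans (ler_norm_avg _ _) _ => //; apply: le_avg => // phi.
case: in_box; last by rewrite mulr0 !subr0 mulr1.
by rewrite mulr1 !subrr normr0 mulr0.
Qed.

End MonoPoisson.

(** * Members of different types that share two elements *)

Section CrossOverlap.
Variables (R : realType) (d : nat) (T A : nat -> finType) (c : nat -> nat).
Variables (S : forall n, A n -> {set T n}) (tau : forall n, A n -> 'I_d).
Variables (e : 'I_d -> nat) (lambda : 'I_d -> R).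
Hypothesis c_gt0 : forall n, (0 < c n)%N.
Hypothesis c_cvg : c n @[n --> \oo] --> \oo.
Hypothesis S_card : forall n (a : A n), #|S a| = e (tau a).
Local Notation mean_at n i := (mean R (c n) (@S n) (@tau n) i).
Local Notation overlap_at n i j := (overlap_sum R (c n) (@S n) (@tau n) i j).
Local Notation energy_at n i s := (degree_energy R (c n) (@S n) (@tau n) i s).
Hypothesis mean_cvg : forall i, mean_at n i @[n --> \oo] --> lambda i.

Lemma overlap_sum_ge0 n i j : 0 <= overlap_at n i j.
Proof. by do 2 apply: sumr_ge0 => ? _; exact: joint_prob_ge0. Qed.

Lemma energy_ge0 n i s : 0 <= energy_at n i s.
Proof.
by apply: sumr_ge0 => J _; rewrite mulr_ge0 ?sqr_ge0 ?exprn_ge0.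
Qed.

Lemma overlap_sum_small n i j : (e i <= 1)%N -> overlap_at n i j = 0.
Proof.
move=> ei; rewrite /overlap_sum big1// => a /eqP ai.
rewrite big_pred0// => b; rewrite /overlap ltnNge (leq_trans _ ei) ?andbF//.
by rewrite -ai -S_card subset_leq_card// subsetIl.
Qed.

(** The bound of [overlap_sum_le_variance] tends to
[2 * (lambda i - lambda i + 0)]. *)
Lemma self_overlap_cvg i (v : nat -> R) : (1 < e i)%N ->
    (forall n, v n = avg (fun phi =>
       ((mono_number (c := c n) (@S n) (@tau n) phi i)%:R - mean_at n i) ^+ 2)) ->
    v n @[n --> \oo] --> lambda i ->
  overlap_at n i i @[n --> \oo] --> (0 : R).
Proof.
move=> ei vE v_cvg.
have ub_cvg : 2 * (v n - mean_at n i + mean_at n i / (c n)%:R) @[n --> \oo] --> (0 : R).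
  rewrite -[X in _ --> X](_ : 2 * (lambda i - lambda i + lambda i * 0) = 0).
    apply: cvgMl_tmp; apply: cvgD; first exact: cvgB.
    by apply: cvgM => //; exact: invc_cvg.
  by rewrite subrr !(mulr0, addr0).
apply: squeeze_cvgr (cvg_cst 0) ub_cvg; near=> n.
rewrite overlap_sum_ge0 vE; apply: overlap_sum_le_variance => //.
  by near: n; move/cvgnyPgt : c_cvg; exact.
by move=> a /eqP ai; rewrite S_card ai.
Unshelve. all: by end_near.
Qed.

Hypothesis self_cvg : forall i, overlap_at n i i @[n --> \oo] --> (0 : R).

Let energy_bound i n : R := 2 ^+ e i * (1 * mean_at n i + overlap_at n i i).

Let energy_le i n s : energy_at n i s <= energy_bound i n.
Proof.
apply: degree_energy_le => // [a /eqP <-//|k _ ke].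
by rewrite mul1r ler_weXn2l ?ler1n// -!subn1 leq_sub2r.
Qed.

Let energy_bound_cvg i : energy_bound i n @[n --> \oo] --> 2 ^+ e i * lambda i.
Proof.
apply: cvgMl_tmp; rewrite -[X in _ --> X]addr0; apply: cvgD => //.
by under eq_fun do rewrite mul1r; exact: mean_cvg.
Qed.

Let energy_small i s : (s <= e i)%N -> (1 < e i)%N ->
  energy_at n i s @[n --> \oo] --> (0 : R).
Proof.
move=> se ei.
have ub_cvg : 2 ^+ e i * ((c n)%:R^-1 * mean_at n i + overlap_at n i i)
    @[n --> \oo] --> (0 : R).
  rewrite -[X in _ --> X](_ : 2 ^+ e i * (0 * lambda i + 0) = 0).
    apply: cvgMl_tmp; apply: cvgD => //.
    by apply: cvgM => //; exact: invc_cvg.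
  by rewrite !(mul0r, mulr0, addr0).
apply: squeeze_cvgr (cvg_cst 0) ub_cvg; apply: nearW => n.
rewrite energy_ge0; apply: degree_energy_le => //.
  by move=> a /eqP <-.
move=> k ks _; have ke := leq_trans ks se.
move: ei ke; case: (e i) => [//|[//|m]] _ ke /=.
rewrite exprS mulKf ?pnatr_eq0 -?lt0n// ler_weXn2l ?ler1n//.
by case: k {ks} ke => // k; rewrite !ltnS.
Qed.

(** Two different sets of sizes [e i] and [e j] meet in fewer than
[maxn (e i) (e j)] elements, so that the energy of the type with the larger sets,
cut off at this size, vanishes in the limit.  When members may coincide there is no
such gain, but a zero mean in the limit makes the energy of that type vanish. *)
Lemma cross_overlap_cvg i j :
    (forall n (a b : A n), tau a = i -> tau b = j -> b != a -> S a != S b)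
    \/ lambda i = 0 \/ lambda j = 0 ->
  overlap_at n i j @[n --> \oo] --> (0 : R).
Proof.
have zero_cvg : (fun=> 0 : R) @ \oo --> (0 : R) by exact: cvg_cst.
move=> disj.
have [ei|ei] := leqP (e i) 1.
  by rewrite (_ : (fun n => _) = fun=> 0)//; apply/funext => n; exact: overlap_sum_small.
have [ej|ej] := leqP (e j) 1.
  rewrite (_ : (fun n => _) = fun=> 0)//; apply/funext => n.
  rewrite /overlap_sum big1// => a /eqP ai.
  rewrite big_pred0// => b; apply/negP => /and3P[/eqP bj _].
  rewrite /overlap ltnNge (leq_trans _ ej)//.
  by rewrite -bj -S_card subset_leq_card// subsetIr.
have [ub ub_cvg ub_le] : exists2 ub : nat -> R, ub n @[n --> \oo] --> (0 : R) &
    forall n, overlap_at n i j ^+ 2 <= ub n.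
  have tot n s : (forall a b, tau a = i -> tau b = j -> b != a ->
      overlap (@S n) a b -> (#|S a :&: S b| < s)%N) ->
      overlap_at n i j ^+ 2 <= energy_at n i s * energy_at n j s.
    exact: overlap_sum_le_energy.
  case: disj => [Sab|[lam0|lam0]].
  - exists (fun n => energy_at n i (maxn (e i) (e j)) * energy_at n j (maxn (e i) (e j))).
      have [eij|eji] := leqP (e i) (e j).
        have small : energy_bound i n * energy_at n j (e j) @[n --> \oo] --> (0 : R).
          rewrite -[X in _ --> X](mulr0 (2 ^+ e i * lambda i)).
          by apply: cvgM => //; exact: energy_small.
        apply: squeeze_cvgr (cvg_cst 0) small; apply: nearW => n.
        by rewrite mulr_ge0 ?energy_ge0// ler_wpM2r ?energy_ge0.
      have small : energy_at n i (e i) * energy_bound j n @[n --> \oo] --> (0 : R).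
        rewrite -[X in _ --> X](mul0r (2 ^+ e j * lambda j)).
        by apply: cvgM => //; exact: energy_small.
      apply: squeeze_cvgr (cvg_cst 0) small; apply: nearW => n.
      by rewrite mulr_ge0 ?energy_ge0// ler_wpM2l ?energy_ge0.
    move=> n; apply: tot => a b ai bj ba _; rewrite ltnNge; apply/negP => le_t.
    have [ti tj] : (#|S a :&: S b| <= e i)%N /\ (#|S a :&: S b| <= e j)%N.
      by rewrite -ai -bj -!S_card !subset_leq_card ?subsetIl ?subsetIr.
    have /negP := Sab _ _ _ ai bj ba; apply.
    have /eqP <- : S a :&: S b == S a.
      by rewrite eqEcard subsetIl S_card ai (leq_trans _ le_t)// leq_maxl.
    by rewrite eqEcard subsetIr S_card bj (leq_trans _ le_t)// leq_maxr.
  - exists (fun n => energy_bound i n * energy_bound j n).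
      rewrite -[X in _ --> X](mul0r (2 ^+ e j * lambda j)); apply: cvgM => //.
      by have := @energy_bound_cvg i; rewrite lam0 mulr0.
    move=> n; apply: le_trans (tot n (e i).+1 _) _.
      move=> a b ai _ _ _; rewrite ltnS -ai -S_card subset_leq_card//.
      exact: subsetIl.
    by rewrite ler_pM ?energy_ge0.
  - exists (fun n => energy_bound i n * energy_bound j n).
      rewrite -[X in _ --> X](mulr0 (2 ^+ e i * lambda i)); apply: cvgM => //.
      by have := @energy_bound_cvg j; rewrite lam0 mulr0.
    move=> n; apply: le_trans (tot n (e i).+1 _) _.
      move=> a b ai _ _ _; rewrite ltnS -ai -S_card subset_leq_card//.
      exact: subsetIl.
    by rewrite ler_pM ?energy_ge0.
have sqrt_cvg : Num.sqrt (ub n) @[n --> \oo] --> (0 : R).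
  rewrite -[X in _ --> X](sqrtr0 R); apply: continuous_cvg => //.
  exact: sqrt_continuous.
apply: squeeze_cvgr (cvg_cst 0) sqrt_cvg; apply: nearW => n.
rewrite overlap_sum_ge0 -[leLHS]ger0_norm ?overlap_sum_ge0// -sqrtr_sqr.
exact: ler_wsqrtr.
Qed.

End CrossOverlap.

(** * Copies of graphs *)

Lemma is_copyP (F G : sgraph) (S : {set vert G} * {set {set vert G}}) :
  is_copy F S -> S.2 \subset edges G /\
    exists f : vert F -> vert G,
      [/\ injective f, (f @: [set: vert F] = S.1)%SET &
          [set f @: (e : {set vert F}) | e in edges F]%SET = S.2].
Proof.
move=> /andP[SG /existsP[f /and3P[/injectiveP injf /eqP S1 /eqP S2]]].
by split=> //; exists f.
Qed.

Lemma card_copy_edges (F G : sgraph) (S : {set vert G} * {set {set vert G}}) :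
  is_copy F S -> #|S.2| = #|edges F|.
Proof.
by move=> /is_copyP[_ [f [injf _ <-]]]; rewrite card_imset//; exact: imset_inj.
Qed.

Definition isolated_vertex (F : sgraph) (v : vert F) : Prop :=
  forall e, e \in edges F -> v \notin e.

Lemma copy_vertices_cover (F G : sgraph) (S : {set vert G} * {set {set vert G}}) :
  is_copy F S -> (forall v : vert F, ~ isolated_vertex v) -> S.1 = finset.cover S.2.
Proof.
move=> /is_copyP[_ [f [injf S1 S2]]] noiso; apply/setP => u.
rewrite -S1 -S2; apply/imsetP/bigcupP => [[v _ ->]|[_ /imsetP[e eF ->]]].
  have /existsNP[e /not_implyP[eF /negP]] := noiso v; rewrite negbK => ve.
  by exists (f @: e)%SET; rewrite imset_f.
by move=> /imsetP[v _ ->]; exists v.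
Qed.

(** In the absence of isolated vertices both copies have for vertices the endpoints of
the common edges, so the two parametrizations can be composed. *)
Lemma same_edges_isomorphic (F F' G : sgraph)
    (S S' : {set vert G} * {set {set vert G}}) :
    is_copy F S -> is_copy F' S' -> S.2 = S'.2 ->
    (forall v : vert F, ~ isolated_vertex v) ->
    (forall v : vert F', ~ isolated_vertex v) ->
  isomorphic F F'.
Proof.
move=> cF cF' SS' noiso noiso'.
have S11 : S.1 = S'.1.
  by rewrite (copy_vertices_cover cF)// (copy_vertices_cover cF')// SS'.
have [_ [f [injf fS1 fS2]]] := is_copyP cF.
have [_ [f' [injf' fS1' fS2']]] := is_copyP cF'.
have : forall x : vert F, exists y : vert F', f' y = f x.
  move=> x; have : f x \in (f' @: [set: vert F'])%SET.
    by rewrite fS1' -S11 -fS1 imset_f// inE.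
  by move=> /imsetP[y _ ->]; exists y.
move=> /fin_all_exists[h hf]; exists h; split.
  apply: inj_card_bij => [x y /(congr1 f')|]; first by rewrite !hf => /injf.
  rewrite -cardsT -(card_imset _ injf') fS1' -S11 -fS1 card_imset//.
  by rewrite cardsT.
apply: (imset_inj (imset_inj injf')); rewrite fS2' -SS' -fS2 -imset_comp.
apply: eq_imset => e /=; rewrite -imset_comp.
exact: eq_imset.
Qed.

(** Move the image of the isolated vertex to a vertex of [G] off the copy. *)
Lemma isolated_vertex_copy (F G : sgraph) (v : vert F)
    (S : {set vert G} * {set {set vert G}}) :
    isolated_vertex v -> (#|vert F| < #|vert G|)%N -> is_copy F S ->
  exists S', [/\ is_copy F S', S' != S & S'.2 = S.2].
Proof.
move=> viso FG cS; have [SG [f [injf fS1 fS2]]] := is_copyP cS.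
have [u uS] : exists u, u \notin S.1.
  apply/existsP; rewrite -negb_forall; apply/negP => /forallP allS.
  move: FG; rewrite -cardsT -(card_imset _ injf) fS1 ltnNge => /negP; apply.
  by rewrite -cardsT subset_leq_card//; apply/fintype.subsetP => u _.
pose f' := [ffun x => if x == v then u else f x].
have uf x : u != f x.
  by apply: contraNneq uS => ->; rewrite -fS1 imset_f// inE.
have injf' : injective f'.
  move=> x y; rewrite !ffunE; case: (altP (x =P v)) => [->|_].
    by case: (altP (y =P v)) => // _ /eqP; rewrite (negbTE (uf _)).
  case: (altP (y =P v)) => [_ /esym/eqP|_ /injf//].
  by rewrite (negbTE (uf _)).
exists ((f' @: [set: vert F])%SET, S.2); split=> //.
  rewrite /is_copy /= SG; apply/existsP; exists f'.
  apply/and3P; split; [exact/injectiveP|exact: eqxx|].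
  rewrite -fS2; apply/eqP/eq_in_imset => e eF; apply: eq_in_imset => x xe.
  by rewrite ffunE; case: eqP => // xv; have := viso e eF; rewrite -xv xe.
apply: contraNneq uS => <- /=; apply/imsetP; exists v => //.
by rewrite ffunE eqxx.
Qed.

(** All copies of all the graphs [F i] in [G], as the index set of one family. *)
Definition copies d (F : 'I_d -> sgraph) (G : sgraph) : finType :=
  {u in [set u : 'I_d * ({set vert G} * {set {set vert G}}) |
           is_copy (F u.1) u.2]%SET}.

Section Copies.
Variables (d : nat) (F : 'I_d -> sgraph) (G : sgraph).

Definition copy_type (u : copies F G) : 'I_d := (val u).1.
Definition copy_edges (u : copies F G) : {set {set vert G}} := (val u).2.2.

Lemma copyP (u : copies F G) : is_copy (F (copy_type u)) (val u).2.
Proof. by have := valP u; rewrite inE. Qed.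

Lemma card_copy_edges_type (u : copies F G) :
  #|copy_edges u| = #|edges (F (copy_type u))|.
Proof. exact/card_copy_edges/copyP. Qed.

Lemma copy_ex i (S : {set vert G} * {set {set vert G}}) : is_copy (F i) S ->
  exists u : copies F G, val u = (i, S).
Proof.
move=> cS; have iS : (i, S) \in [set u : 'I_d * ({set vert G} * {set {set vert G}}) |
           is_copy (F u.1) u.2]%SET by rewrite inE.
by exists (exist (fun u => is_true (u \in _)) (i, S) iS).
Qed.

Lemma mono_copies_sum (C : eqType) (col : {set vert G} -> C) i :
  mono_copies (F i) col =
  (\sum_(u : copies F G | copy_type u == i) mono col (copy_edges u))%N.
Proof.
rewrite /copy_type /copy_edges.
rewrite -(big_sub_cond _ (fun u => u.1 == i) (fun u => mono col u.2.2 : nat)).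
rewrite (eq_bigl (fun u => (u.1 == i) && is_copy (F u.1) u.2)); last first.
  by move=> u; rewrite inE andbC.
rewrite -(pair_big_dep (fun j => j == i) (fun j S => is_copy (F j) S)
  (fun j S => mono col S.2 : nat)) /= big_pred1_eq.
rewrite /mono_copies -sum1_card big_mkcond [RHS]big_mkcond /=.
by apply: eq_bigr => S _; rewrite inE; case: is_copy => //=; case: ifP.
Qed.

Lemma mono_number_copies c (phi : {ffun {set vert G} -> 'I_c}) i :
  mono_number copy_edges copy_type phi i =
  mono_copies (F i) (fun e => (phi e).+1).
Proof.
by rewrite ffunE mono_copies_sum; apply: eq_bigr.
Qed.

End Copies.

(** * Vectors of integer random variables *)

Section DiscreteVector.
Variables (R : realType) (disp : measure_display) (Omega : measurableType disp).
Variables (P : probability Omega R) (I : finType) (Y : I -> {RV P >-> nat}).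

Definition rv_vector (w : Omega) : {ffun I -> nat} := [ffun i => Y i w].

Definition vector_mean (h : {ffun I -> nat} -> R) : R :=
  \int[P]_w h (rv_vector w).

Lemma measurable_rv_vector (B : set {ffun I -> nat}) :
  measurable (rv_vector @^-1` B).
Proof.
have -> : rv_vector @^-1` B = \bigcup_(y : {ffun I -> nat})
    ([set w | B y /\ forall i, Y i w = y i]).
  apply/seteqP; split=> [w Bw|w [y _ [By wy]]].
    by exists (rv_vector w) => //; split=> // i; rewrite ffunE.
  by rewrite /= (_ : rv_vector w = y)//; apply/ffunP => i; rewrite ffunE.
apply: countable_bigcupT_measurable => [|y]; first exact: countableP.
have [By|nBy] := pselect (B y); last first.
  by rewrite (_ : mkset _ = set0) ?measurable0//; apply/seteqP; split=> // w [].
rewrite (_ : mkset _ = \bigcap_i (Y i @^-1` [set y i])).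
  apply: fin_bigcap_measurable => [|i _]; first exact: finite_finset.
  by rewrite -[X in measurable X]setTI; apply: measurable_funPT.
by apply/seteqP; split=> [w [_ wy] i _|w wy]; [exact: wy|split=> // i; exact: wy].
Qed.

Lemma measurable_fun_rv_vector (h : {ffun I -> nat} -> R) :
  measurable_fun setT (h \o rv_vector).
Proof.
by move=> _ B _; rewrite setTI comp_preimage; exact: measurable_rv_vector.
Qed.

Lemma integrable_rv_vector (h : {ffun I -> nat} -> R) (B : R) :
  (forall y, `|h y| <= B) -> P.-integrable setT (EFin \o (h \o rv_vector)).
Proof.
move=> hB; apply: measurable_bounded_integrable => //.
- exact: le_lt_trans (probability_le1 P measurableT) (ltry 1).
- exact: measurable_fun_rv_vector.
exists B; split; first exact: num_real.
by move=> r Br w _ /=; rewrite (le_trans (hB _))// ltW.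
Qed.

Lemma expectation_rv_vector (h : {ffun I -> nat} -> R) (B : R) :
  (forall y, `|h y| <= B) -> 'E_P[h \o rv_vector]%E = (vector_mean h)%:E.
Proof.
move=> hB; rewrite unlock /vector_mean /Rintegral fineK//.
exact/integrable_fin_num/integrable_rv_vector.
Qed.

Lemma vector_mean_sum (J : finType) (h : J -> {ffun I -> nat} -> R) (B : J -> R) :
    (forall j y, `|h j y| <= B j) ->
  vector_mean (fun y => \sum_j h j y) = \sum_j vector_mean (h j).
Proof.
move=> hB; rewrite /vector_mean /Rintegral.
under eq_integral do rewrite -sumEFin.
rewrite integral_sum//; last by move=> j; exact: integrable_rv_vector (hB j).
rewrite sum_fine// => j _.
exact/integrable_fin_num/(integrable_rv_vector (hB j)).
Qed.

Lemma vector_meanB (h h' : {ffun I -> nat} -> R) (B B' : R) :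
    (forall y, `|h y| <= B) -> (forall y, `|h' y| <= B') ->
  vector_mean (fun y => h y - h' y) = vector_mean h - vector_mean h'.
Proof.
move=> hB hB'; rewrite /vector_mean RintegralB//.
  exact: integrable_rv_vector hB.
exact: integrable_rv_vector hB'.
Qed.

Lemma vector_meanZ k (h : {ffun I -> nat} -> R) (B : R) :
    (forall y, `|h y| <= B) ->
  vector_mean (fun y => k * h y) = k * vector_mean h.
Proof.
by move=> hB; rewrite /vector_mean RintegralZl//; exact: integrable_rv_vector hB.
Qed.

Lemma vector_mean_bool (b : {ffun I -> nat} -> bool) :
  vector_mean (fun y => (b y)%:R) = fine (P [set w | b (rv_vector w)]).
Proof.
rewrite /vector_mean /Rintegral; congr fine.
rewrite -[X in P X]setIT -integral_indic//; last first.
  exact: (measurable_rv_vector [set y | b y]).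
apply: eq_integral => w _; rewrite indicE (_ : (w \in _) = b (rv_vector w))//.
by apply/idP/idP; rewrite inE.
Qed.

Lemma vector_mean_cst k : vector_mean (fun=> k) = k.
Proof.
rewrite /vector_mean Rintegral_cst// -[RHS]mulr1.
transitivity (k * fine (1%:E : \bar R)); last by [].
congr (_ * fine _).
exact: probability_setT.
Qed.

Lemma le_vector_mean (h h' : {ffun I -> nat} -> R) (B B' : R) :
    (forall y, `|h y| <= B) -> (forall y, `|h' y| <= B') ->
  (forall y, h y <= h' y) -> vector_mean h <= vector_mean h'.
Proof.
move=> hB hB' hh'; apply: le_Rintegral => //.
  exact: integrable_rv_vector hB.
exact: integrable_rv_vector hB'.
Qed.

(** Truncating a bounded function costs at most its bound times the probability
of the complement. *)
Lemma vector_mean_truncate (h : {ffun I -> nat} -> R) (b : {ffun I -> nat} -> bool)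
    (B : R) : (forall y, `|h y| <= B) ->
  `|vector_mean h - vector_mean (fun y => h y * (b y)%:R)| <=
  B * (1 - vector_mean (fun y => (b y)%:R)).
Proof.
move=> hB.
have b1 y : `|(b y)%:R : R| <= 1 by case: (b y); rewrite ?normr0 ?normr1.
have hb y : `|h y * (b y)%:R| <= B.
  by rewrite normrM (le_trans _ (hB y))// ler_piMr.
have hnb y : `|h y - h y * (b y)%:R| <= B.
  by case: (b y); rewrite ?mulr1 ?subrr ?mulr0 ?subr0 ?normr0// (le_trans _ (hB y)).
have nb1 y : `|1 - (b y)%:R : R| <= 1.
  by case: (b y); rewrite ?subrr ?subr0 ?normr0 ?normr1.
rewrite -(vector_meanB hB hb).
rewrite -[X in X - vector_mean _](vector_mean_cst 1).
rewrite -(@vector_meanB (fun=> 1) _ 1 1)// ?normr1//.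
rewrite -(vector_meanZ _ nb1).
rewrite (le_trans (le_normr_Rintegral _ _ ))//.
  exact: (integrable_rv_vector hnb).
apply: (@le_vector_mean (fun y => `|h y - h y * (b y)%:R|)
  (fun y => B * (1 - (b y)%:R)) B (`|B| * 1)) => [y|y|y].
- by rewrite normr_id.
- by rewrite normrM ler_wpM2l.
by case: (b y); rewrite ?mulr1 ?subrr ?normr0 ?mulr0 ?subr0 ?mulr1.
Qed.

End DiscreteVector.

(** * Expectations over a random edge coloring *)

Section Transport.
Variables (R : realType) (disp : measure_display) (Omega : measurableType disp).
Variables (P : probability Omega R) (G : sgraph) (c : nat).
Variable chi : {set vert G} -> {RV P >-> nat}.
Hypothesis c_gt0 : (0 < c)%N.
Hypothesis chi_uniform : uniform_edge_coloring c chi.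
Local Notation E := (edges G).
Local Notation coloring := {ffun {set vert G} -> 'I_c}.
Local Notation Emean := (vector_mean chi).

(** Ordinals start at 0, the colors at 1. *)
Definition shift_coloring (phi : coloring) : {ffun {set vert G} -> nat} :=
  [ffun e => (phi e).+1].

Let agree phi (y : {ffun {set vert G} -> nat}) : bool :=
  [forall e in E, y e == shift_coloring phi e].

Let good (y : {ffun {set vert G} -> nat}) : bool :=
  [forall e in E, (0 < y e <= c)%N].

Let bool_le1 (b : bool) : `|b%:R : R| <= 1.
Proof. by case: b; rewrite ?normr0 ?normr1. Qed.

(** If [y] uses only the colors [1..c] on the edges, the colorings that agree with
it on the edges are those with arbitrary values on the other sets. *)
Lemma sum_agree y :
  \sum_(phi : coloring) (agree phi y)%:R = (c ^ #|~: E|)%:R * (good y)%:R :> R.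
Proof.
have [/forall_inP yg|yng] := boolP (good y); last first.
  rewrite mulr0 big1// => phi _; case: (boolP (agree phi y)) => // /forall_inP yphi.
  case/negP: yng; apply/forall_inP => e eE.
  by rewrite (eqP (yphi e eE)) ffunE /= ltn_ord.
pose phi0 : coloring := [ffun e => insubd (Ordinal c_gt0) (y e).-1].
have yphi0 e : e \in E -> y e = (phi0 e).+1.
  move=> /yg/andP[y0 yc]; rewrite ffunE val_insubd.
  by case: (y e) y0 yc => // k _ /= ->.
rewrite mulr1 -(card_agree E phi0) -natr_sum -big_mkcond /= sum1_card.
congr (_%:R); apply: eq_card => phi; rewrite !inE unfold_in /agree.
apply: eq_forallb_in => e eE; rewrite ffunE yphi0//.
by rewrite eqSS eq_sym.
Qed.

Lemma mean_agree phi : Emean (fun y => (agree phi y)%:R) = c%:R ^- #|E|.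
Proof.
rewrite vector_mean_bool; have [unif indep] := chi_uniform.
have -> : [set w | agree phi (rv_vector chi w)] =
    \bigcap_(e in [set` E]) (chi e @^-1` [set (phi e).+1]).
  apply/seteqP; split=> [w /forall_inP agr e eE /=|w agr].
    by have /eqP := agr e eE; rewrite !ffunE.
  by apply/forall_inP => e eE; rewrite !ffunE; apply/eqP/agr.
rewrite (indep E (fun e => [set (phi e).+1]))//.
under eq_bigr => e eE.
  rewrite [X in P X](_ : _ = [set w | chi e w = (phi e).+1])//.
  rewrite (unif e _ eE) /= ?ltn_ord//.
  over.
rewrite prodEFin/= prodr_const.
by rewrite exprVn.
Qed.

(** The [c ^ #|E|] possible color patterns have total probability 1. *)
Lemma mean_good : Emean (fun y => (good y)%:R) = 1.
Proof.
have N0 : (c ^ #|~: E|)%:R != 0 :> R by rewrite pnatr_eq0 -lt0n expn_gt0 c_gt0.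
apply: (mulfI N0); rewrite mulr1 -(@vector_meanZ _ _ _ _ _ _ _ _ 1)//.
rewrite (_ : (fun y => _ * _) = fun y => \sum_phi (agree phi y)%:R); last first.
  by apply/funext => y; rewrite sum_agree.
rewrite (@vector_mean_sum _ _ _ _ _ _ _ _ (fun=> 1))//.
under eq_bigr do rewrite mean_agree.
rewrite sumr_const card_ffun card_ord -[_ *+ _]mulr_natl -(cardsC E) expnD natrM.
by rewrite mulrAC -natrX mulfV ?mul1r// pnatr_eq0 -lt0n expn_gt0 c_gt0.
Qed.

(** Almost surely the edge colors lie in [1..c], and then [h] is the sum of its values
on the possible color patterns, each of probability [c ^- #|E|]; every pattern comes
from [c ^ #|~: E|] colorings of all sets of vertices. *)
Lemma vector_mean_avg (h : {ffun {set vert G} -> nat} -> R) (B : R) :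
    (forall y, `|h y| <= B) ->
    (forall y z : {ffun {set vert G} -> nat}, {in E, y =1 z} -> h y = h z) ->
  Emean h = avg (fun phi => h (shift_coloring phi)).
Proof.
move=> hB hE.
have N0 : (c ^ #|~: E|)%:R != 0 :> R by rewrite pnatr_eq0 -lt0n expn_gt0 c_gt0.
have hgood : Emean h = Emean (fun y => h y * (good y)%:R).
  apply/eqP; rewrite -subr_eq0 -normr_le0.
  by have := vector_mean_truncate chi good hB; rewrite mean_good subrr mulr0.
apply: (mulfI N0); rewrite hgood.
have hgB y : `|h y * (good y)%:R| <= B.
  by rewrite normrM (le_trans _ (hB y))// ler_piMr.
rewrite -(vector_meanZ _ _ hgB).
have expand y : (c ^ #|~: E|)%:R * (h y * (good y)%:R) =
    \sum_(phi : coloring) h (shift_coloring phi) * (agree phi y)%:R.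
  rewrite mulrCA -sum_agree mulr_sumr; apply: eq_bigr => phi _.
  case: (boolP (agree phi y)) => [/forall_inP agr|_]; last by rewrite !mulr0.
  by congr (_ * _); apply: hE => e eE; apply/eqP/agr.
rewrite (funext expand).
rewrite (@vector_mean_sum _ _ _ _ _ _ _ _ (fun=> B)); last first.
  by move=> phi y; rewrite normrM (le_trans _ (hB (shift_coloring phi)))// ler_piMr.
under eq_bigr => phi _ do rewrite (@vector_meanZ _ _ _ _ _ _ _ _ 1)// mean_agree.
rewrite -mulr_suml /avg mulrCA; congr (_ * _).
rewrite -(cardsC E) expnD natrM invfM mulrCA mulfV// mulr1 natrX.
by [].
Qed.

Lemma expectation_avg (h : ({set vert G} -> nat) -> R) (B : R) :
    (forall y, `|h y| <= B) ->
    (forall y z, {in E, y =1 z} -> h y = h z) ->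
  'E_P[fun w => h (fun e => chi e w)]%E =
  (avg (fun phi : coloring => h (fun e => (phi e).+1)))%:E.
Proof.
move=> hB hE.
have -> : (fun w => h (fun e => chi e w)) =
    (fun y : {ffun {set vert G} -> nat} => h y) \o rv_vector chi.
  by apply/funext => w; apply: hE => e _ /=; rewrite ffunE.
rewrite (@expectation_rv_vector _ _ _ _ _ _ _ B)//; congr EFin.
rewrite (@vector_mean_avg _ B)//; last by move=> y z yz; apply: hE.
by apply: eq_avg => phi; apply: hE => e _; rewrite ffunE.
Qed.

End Transport.

(** * Vectors of independent Poisson variables *)

Section PoissonVector.
Variables (R : realType) (d : nat) (lambda : 'I_d -> R).
Variables (disp : measure_display) (Omega : measurableType disp).
Variables (Q : probability Omega R) (Z : 'I_d -> {RV Q >-> nat}).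
Hypothesis lambda_ge0 : forall i, 0 <= lambda i.
Hypothesis Z_poisson : forall i, distribution Q (Z i) =1 poisson_prob (lambda i) 0%N.
Hypothesis Z_indep : mutually_independent Q [set: 'I_d]%SET Z.

Definition joint_law (y : {ffun 'I_d -> nat}) : R :=
  vector_mean Z (fun z => (z == y)%:R).

Let point i k : R := fine (Q (Z i @^-1` [set k])).

Let point_rec i k : k.+1%:R * point i k.+1 = lambda i * point i k.
Proof.
rewrite /point; have := Z_poisson i; rewrite /distribution /pushforward => Zi.
rewrite !Zi /poisson_prob; have [lam_gt0|lam_le0] := ltP 0 (lambda i).
  rewrite !esum_set1 ?lee_fin ?poisson_pmf_ge0//= /poisson_pmf lam_gt0.
  rewrite factS natrM invfM exprS !mulrA; congr (_ * _).
  rewrite -!mulrA mulrCA; congr (_ * _); rewrite mulrCA; congr (_ * _).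
  by rewrite mulrA mulfV ?mul1r// pnatr_eq0.
have -> : lambda i = 0 by apply/eqP; rewrite eq_le lam_le0 lambda_ge0.
rewrite mul0r !diracE memNset/= ?mulr0//.
Qed.

Let joint_law_prod y : joint_law y = \prod_i point i (y i).
Proof.
rewrite /joint_law vector_mean_bool.
have -> : [set w | rv_vector Z w == y] =
    \bigcap_(i in [set` [set: 'I_d]%SET]) (Z i @^-1` [set y i]).
  apply/seteqP; split=> [w /= /eqP <- i _ /=|w Zw /=]; first by rewrite ffunE.
  by apply/eqP/ffunP => i; rewrite ffunE; apply: Zw => /=; rewrite inE.
rewrite (Z_indep (A := fun i => [set y i]))// /point.
have -> : (\prod_(i in [set: 'I_d]%SET) Q (Z i @^-1` [set y i]) =
    \prod_i (fine (Q (Z i @^-1` [set y i])))%:E)%E.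
  apply: eq_big => [i|i _]; first by rewrite inE.
  rewrite fineK//; apply: fin_num_measure.
  by rewrite -[X in measurable X]setTI; apply: measurable_funPT.
by rewrite prodEFin.
Qed.

Lemma joint_law_rec i (y : {ffun 'I_d -> nat}) :
  (y i).+1%:R * joint_law (increment i y) = lambda i * joint_law y.
Proof.
rewrite !joint_law_prod (bigD1 i)//= [in RHS](bigD1 i)//= !mulrA ffunE eqxx addn1.
rewrite point_rec; congr (_ * _); apply: eq_bigr => j ji.
by rewrite ffunE (negbTE ji) addn0.
Qed.

Lemma joint_law_ge0 y : 0 <= joint_law y.
Proof. by apply: Rintegral_ge0. Qed.

Lemma box_joint_law M (f : {ffun 'I_d -> nat} -> R) (B : R) :
    (forall y, `|f y| <= B) ->
  \sum_(x : {ffun 'I_d -> 'I_M}) f (box_point x) * joint_law (box_point x) =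
  vector_mean Z (fun z => f z * (in_box M z)%:R).
Proof.
move=> fB.
have bool_le1 (b : bool) : `|b%:R : R| <= 1.
  by case: b; rewrite ?normr0 ?normr1.
rewrite (_ : (fun z => _ * (in_box M z)%:R) =
  fun z => \sum_(x : {ffun 'I_d -> 'I_M}) f (box_point x) * (z == box_point x)%:R).
  rewrite (@vector_mean_sum _ _ _ _ _ _ _ _ (fun=> B)).
    by apply: eq_bigr => x _; rewrite (@vector_meanZ _ _ _ _ _ _ _ _ 1).
  by move=> x z; rewrite normrM (le_trans _ (fB (box_point x)))// ler_piMr.
by apply/funext => z; rewrite sum_box.
Qed.

Lemma box_joint_law1 M :
  \sum_(x : {ffun 'I_d -> 'I_M}) joint_law (box_point x) =
  vector_mean Z (fun z => (in_box M z)%:R).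
Proof.
have := @box_joint_law M (fun=> 1) 1 (fun=> _).
under eq_bigr do rewrite mul1r.
rewrite (_ : (fun z => 1 * (in_box M z)%:R) = fun z => (in_box M z)%:R); last first.
  by apply/funext => z; rewrite mul1r.
by apply; rewrite normr1.
Qed.

Lemma box_joint_law_le1 M :
  \sum_(x : {ffun 'I_d -> 'I_M}) joint_law (box_point x) <= 1.
Proof.
rewrite box_joint_law1 -[leRHS](vector_mean_cst Z 1).
apply: (@le_vector_mean _ _ _ _ _ _ _ _ 1 1) => [z|z|z].
- by case: in_box; rewrite ?normr0 ?normr1.
- by rewrite normr1.
by rewrite lern1 leq_b1.
Qed.

Lemma joint_law_tight :
  \sum_(x : {ffun 'I_d -> 'I_M}) joint_law (box_point x) @[M --> \oo] --> (1 : R).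
Proof.
under eq_fun do rewrite box_joint_law1 vector_mean_bool.
pose U M := [set w | in_box M (rv_vector Z w)].
have mU M : measurable (U M).
  exact: (measurable_rv_vector Z [set y | in_box M y]).
have -> : 1 = fine (Q (\bigcup_M U M)).
  rewrite (_ : \bigcup_M U M = setT) ?probability_setT//.
  apply/seteqP; split=> // w _; exists (\sum_i rv_vector Z w i).+1 => //.
  by apply/forallP => i; rewrite ltnS (bigD1 i)//= leq_addr.
apply: fine_cvg; rewrite fineK; last first.
  by apply: fin_num_measure; exact: bigcupT_measurable.
apply: nondecreasing_cvg_mu => //; first exact: bigcupT_measurable.
move=> M M' MM'; apply/subsetPset => w /forallP wM; apply/forallP => i.
exact: leq_trans (wM i) MM'.
Qed.

End PoissonVector.

(** * The theorem for graphs *)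

Section MonoCountMoments.
Variables (R : realType) (d : nat) (F : 'I_d -> sgraph) (G : sgraph) (c : nat).
Variables (disp : measure_display) (Omega : measurableType disp).
Variables (P : probability Omega R) (chi : {set vert G} -> {RV P >-> nat}).
Hypothesis c_gt0 : (0 < c)%N.
Hypothesis chi_uniform : uniform_edge_coloring c chi.
Local Notation S := (@copy_edges d F G).
Local Notation tau := (@copy_type d F G).
Local Notation N := (mono_number (c := c) S tau).

Lemma eq_mono_copies (H : sgraph) (C : eqType) (y z : {set vert G} -> C) :
  {in edges G, y =1 z} -> mono_copies H y = mono_copies H z.
Proof.
move=> yz; apply: eq_card => D; rewrite !inE; case: (boolP (is_copy H D)) => //=.
move=> /is_copyP[/fintype.subsetP DG _].
by apply/forall_inP/forall_inP => mD e eD; apply/forall_inP => e' e'D;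
   have /forall_inP/(_ _ e'D) := mD e eD; rewrite !yz ?DG.
Qed.

Let mono_copies_le (H : sgraph) (y : {set vert G} -> nat) :
  (mono_copies H y <= #|{: {set vert G} * {set {set vert G}}}|)%N.
Proof. exact: max_card. Qed.

Lemma expectation_test (f : {ffun 'I_d -> nat} -> R) (B : R) :
    (forall y, `|f y| <= B) ->
  'E_P[fun w => f [ffun i => mono_copies (F i) (fun e => chi e w)]]%E =
  (avg (fun phi => f (N phi)))%:E.
Proof.
move=> fB.
rewrite (@expectation_avg _ _ _ _ _ _ _ c_gt0 chi_uniform
  (fun col => f [ffun i => mono_copies (F i) col]) B)//.
  congr EFin; apply: eq_avg => phi; congr f.
  by apply/ffunP => i; rewrite ffunE mono_number_copies.
move=> y z yz; congr f; apply/ffunP => i; rewrite !ffunE.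
exact: eq_mono_copies.
Qed.

Lemma expectation_mono_count i :
  'E_P[mono_count (F i) chi]%E = (mean R c S tau i)%:E.
Proof.
rewrite -avg_mono_number//.
rewrite (@expectation_avg _ _ _ _ _ _ _ c_gt0 chi_uniform
  (fun col => (mono_copies (F i) col)%:R)
  #|{: {set vert G} * {set {set vert G}}}|%:R).
- by congr EFin; apply: eq_avg => phi; rewrite mono_number_copies.
- by move=> y; rewrite ger0_norm// ler_nat.
by move=> y z yz; rewrite (eq_mono_copies _ yz).
Qed.

Lemma variance_mono_count i :
  'V_P[mono_count (F i) chi]%E =
  (avg (fun phi => ((N phi i)%:R - mean R c S tau i) ^+ 2))%:E.
Proof.
rewrite /variance unlock expectation_mono_count /=.
set m := mean _ _ _ _ _.
rewrite (@expectation_avg _ _ _ _ _ _ _ c_gt0 chi_uniform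
  (fun col => ((mono_copies (F i) col)%:R - m) * ((mono_copies (F i) col)%:R - m))
  ((#|{: {set vert G} * {set {set vert G}}}|%:R + `|m|) ^+ 2)).
- by congr EFin; apply: eq_avg => phi; rewrite mono_number_copies -expr2.
- move=> y; rewrite -expr2 normrX lerXn2r ?nnegrE ?addr_ge0//.
  by rewrite (le_trans (ler_normB _ _))// lerD2r ger0_norm// ler_nat.
by move=> y z yz; rewrite (eq_mono_copies _ yz).
Qed.

End MonoCountMoments.

Section CopiesSequence.
Variables (R : realType) (d : nat) (F : 'I_d -> sgraph) (G : nat -> sgraph).
Variables (c : nat -> nat) (lambda : 'I_d -> R).
Local Notation A n := (copies F (G n)).
Local Notation S n := (@copy_edges d F (G n)).
Local Notation tau n := (@copy_type d F (G n)).
Local Notation e i := #|edges (F i)|.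
Local Notation mean_at n i := (mean R (c n) (S n) (tau n) i).
Local Notation N n := (mono_number (c := c n) (S n) (tau n)).
Local Notation variance n i :=
  (avg (fun phi => ((N n phi i)%:R - mean_at n i) ^+ 2)).
Hypothesis F_nonisomorphic : forall i j, i != j -> ~ isomorphic (F i) (F j).
Hypothesis edges_cvg : #|edges (G n)| @[n --> \oo] --> \oo.
Hypothesis c_cvg : c n @[n --> \oo] --> \oo.
Hypothesis c_gt0 : forall n, (0 < c n)%N.
Hypothesis mean_cvg : forall i, mean_at n i @[n --> \oo] --> lambda i.
Hypothesis variance_cvg : forall i, variance n i @[n --> \oo] --> lambda i.

Let S_card n (a : A n) : #|S n a| = e (tau n a).
Proof. exact: card_copy_edges_type. Qed.

Let lambda_ge0 i : 0 <= lambda i.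
Proof.
apply: (cvgr_to_ge (@variance_cvg i)); apply: nearW => n.
by apply: avg_ge0 => // phi; exact: sqr_ge0.
Qed.

Let few_edges_number i n phi : (e i <= 1)%N ->
  N n phi i = #|[set a : A n | tau n a == i]%SET|.
Proof.
move=> ei; rewrite ffunE -sum1_card; apply: eq_big => a; first by rewrite inE.
move=> /eqP ai; rewrite (_ : mono phi _)//; apply/monoP => x y xS yS.
congr (phi _); apply/eqP; move: ei; rewrite -ai -S_card leq_eqVlt.
rewrite ltnS leqn0 cards_eq0 => /orP[/cards1P[z Sz]|/eqP S0].
  by move: xS yS; rewrite Sz !inE => /eqP-> /eqP->.
by move: xS; rewrite S0 inE.
Qed.

Let few_edges_mean i n : (e i <= 1)%N ->
  mean_at n i = #|[set a : A n | tau n a == i]%SET|%:R.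
Proof.
move=> ei; rewrite -avg_mono_number//.
by under eq_avg do rewrite few_edges_number//; exact: avg_cst.
Qed.

(** A set with at most one element is always monochromatic, so the count is
deterministic and its variance is 0. *)
Lemma few_edges_limit i : (e i <= 1)%N -> lambda i = 0.
Proof.
move=> ei; apply: (cvg_unique _ (@variance_cvg i)); first exact: norm_hausdorff.
rewrite (_ : (fun n => _) = fun=> 0); first exact: cvg_cst.
apply/funext => n; rewrite few_edges_mean//.
under eq_avg do rewrite few_edges_number// subrr expr0n.
exact: avg_cst.
Qed.

(** The deterministic count is an integer that tends to 0. *)
Lemma few_edges_no_copy i : (e i <= 1)%N ->
  \forall n \near \oo, forall a : A n, tau n a != i.
Proof.
move=> ei; near=> n => a; apply/negP => ai.
have : mean_at n i < 1.
  by near: n; apply: (cvgr_lt (lambda i)); [exact: mean_cvg|rewrite few_edges_limit].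
rewrite few_edges_mean// -[X in _ < X]/(1%:R) ltr_nat ltnS leqn0 cards_eq0.
by move=> /eqP S0; have := finset.in_set0 a; rewrite -S0 inE ai.
Unshelve. all: by end_near.
Qed.

Let self_cvg i :
  overlap_sum R (c n) (S n) (tau n) i i @[n --> \oo] --> (0 : R).
Proof.
have [ei|ei] := leqP (e i) 1.
  rewrite (_ : (fun n => _) = fun=> 0); first exact: cvg_cst.
  by apply/funext => n; exact: (@overlap_sum_small R d _ (fun n => A n) c
    (fun n => S n) (fun n => tau n) (fun i => e i) S_card n i i ei).
exact: (self_overlap_cvg (e := fun i => e i) c_gt0 c_cvg S_card mean_cvg ei (fun=> erefl)).
Qed.

(** Every copy [a] has a twin [b] with the same edges; since [a] and [b] are
monochromatic together, the mean is at most the sum over overlapping pairs, which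
vanishes in the limit.  There is room for the twin because many edges need many
vertices. *)
Lemma isolated_vertex_limit i (x : vert (F i)) :
  isolated_vertex x -> lambda i = 0.
Proof.
move=> x_iso; have [/few_edges_limit//|ei] := leqP (e i) 1.
apply/eqP; rewrite eq_le lambda_ge0 andbT.
apply: ler_cvg_to (@mean_cvg i) (@self_cvg i) _; near=> n.
have FG : (#|vert (F i)| < #|vert (G n)|)%N.
  rewrite ltnNge; apply/negP => GF.
  have : (2 ^ #|vert (F i)| < #|edges (G n)|)%N.
    by near: n; move/cvgnyPgt : edges_cvg; exact.
  rewrite ltnNge => /negP; apply.
  rewrite (leq_trans (max_card _))// -[X in (X <= _)%N]cardsT -powersetT.
  by rewrite card_powerset cardsT leq_exp2l.
apply: ler_sum => a /eqP ai.
have := copyP a; rewrite ai => /(isolated_vertex_copy x_iso FG).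
move=> [D [cD Da D2]]; have [b bE] := copy_ex cD.
have bi : tau n b = i by rewrite /copy_type bE.
have Sba : S n b = S n a by rewrite /copy_edges bE D2.
have ba : b != a by apply: contraNneq Da => ba; rewrite -ba bE.
have ab : overlap (S n) a b by rewrite /overlap Sba finset.setIid S_card ai.
rewrite (bigD1 b)/=; last by rewrite bi eqxx ba ab.
rewrite Sba joint_probxx// lerDl.
by apply: sumr_ge0 => b' _; exact: joint_prob_ge0.
Unshelve. all: by end_near.
Qed.

(** Copies of two nonisomorphic graphs with the same edge set exist only if
one of the graphs has an isolated vertex. *)
Lemma copies_overlap_cvg i j :
  overlap_sum R (c n) (S n) (tau n) i j @[n --> \oo] --> (0 : R).
Proof.
case: (eqVneq i j) => [<-//|ij].
apply: (cross_overlap_cvg (e := fun i => e i) c_gt0 c_cvg S_card mean_cvg self_cvg).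
have [[x /isolated_vertex_limit]|iso_i] :=
  pselect (exists x : vert (F i), isolated_vertex x); first by right; left.
have [[x /isolated_vertex_limit]|iso_j] :=
  pselect (exists x : vert (F j), isolated_vertex x); first by right; right.
left=> n a b ai bj _; apply/eqP => Sab; apply: (F_nonisomorphic ij).
have ca := copyP a; have cb := copyP b; rewrite ai in ca; rewrite bj in cb.
apply: (same_edges_isomorphic ca cb Sab) => x xiso.
  by apply: iso_i; exists x.
by apply: iso_j; exists x.
Qed.

Lemma copies_card : \forall n \near \oo,
  forall a, (1 < #|S n a| <= \max_i e i)%N.
Proof.
have : \forall n \near \oo, forall i, (e i <= 1)%N -> forall a : A n, tau n a != i.
  apply: filter_forall => i.
  have [ei|ei] := leqP (e i) 1; last by apply: nearW.
  by have := few_edges_no_copy ei; apply: filterS.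
apply: filterS => n few a; rewrite S_card leq_bigmax andbT ltnNge.
by apply/negP => /few/(_ a); rewrite eqxx.
Qed.

End CopiesSequence.

Theorem mainTheorem7 (R : realType) (d : nat) (F : 'I_d -> sgraph)
    (G : nat -> sgraph) (c : nat -> nat)
    (disp : nat -> measure_display)
    (Omega : forall n, measurableType (disp n))
    (P : forall n, probability (Omega n) R)
    (chi : forall n, {set vert (G n)} -> {RV (P n) >-> nat})
    (lambda : 'I_d -> R)
    (dispZ : measure_display) (OmegaZ : measurableType dispZ)
    (Q : probability OmegaZ R) (Z : 'I_d -> {RV Q >-> nat}) :
  (1 <= d)%N ->
  (forall i j, i != j -> ~ isomorphic (F i) (F j)) ->
  #|edges (G n)| @[n --> \oo] --> \oo ->
  c n @[n --> \oo] --> \oo ->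
  (forall n, (0 < c n)%N) ->
  (forall n, uniform_edge_coloring (c n) (chi n)) ->
  (forall i, 0 <= lambda i) ->
  (forall i, 'E_(P n)[mono_count (F i) (chi n)]%E @[n --> \oo]
               --> (lambda i)%:E) ->
  (forall i, 'V_(P n)[mono_count (F i) (chi n)]%E @[n --> \oo]
               --> (lambda i)%:E) ->
  (* the second argument of poisson_prob is unused *)
  (forall i, distribution Q (Z i) =1 poisson_prob (lambda i) 0%N) ->
  mutually_independent Q [set: 'I_d]%SET Z ->
  cvg_in_distribution P
    (fun n w => \row_i mono_count (F i) (chi n) w)
    Q (fun w => \row_i (Z i w)%:R).
Proof.
move=> _ nonisom edges_cvg c_cvg c_gt0 chi_unif lambda_ge0 E_cvg V_cvg Z_pois Z_indep.
have mean_cvg i : mean R (c n) (@copy_edges d F (G n)) (@copy_type d F (G n)) i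
    @[n --> \oo] --> lambda i.
  rewrite (_ : (fun n => _) = fine \o (fun n => 'E_(P n)[mono_count (F i) (chi n)]%E)).
    exact/fine_cvg/E_cvg.
  by apply/funext => n /=; rewrite (expectation_mono_count F (c_gt0 n)).
have var_cvg i : avg (fun phi =>
      ((mono_number (c := c n) (@copy_edges d F (G n)) (@copy_type d F (G n)) phi i)%:R
       - mean R (c n) (@copy_edges d F (G n)) (@copy_type d F (G n)) i) ^+ 2)
    @[n --> \oo] --> lambda i.
  rewrite (_ : (fun n => _) = fine \o (fun n => 'V_(P n)[mono_count (F i) (chi n)]%E)).
    exact/fine_cvg/V_cvg.
  by apply/funext => n /=; rewrite (variance_mono_count F (c_gt0 n)).
move=> f _ [M fM].
pose g (y : {ffun 'I_d -> nat}) : R := f (\row_i (y i)%:R).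
have gM y : `|g y| <= M by exact: fM.
have EX n : 'E_(P n)[f \o (fun w => \row_i mono_count (F i) (chi n) w)]%E =
    (avg (fun phi => g (mono_number (c := c n) (@copy_edges d F (G n))
                          (@copy_type d F (G n)) phi)))%:E.
  rewrite -(expectation_test F (c_gt0 n) (chi_unif n) gM); congr expectation.
  by apply/funext => w /=; congr f; apply/rowP => i; rewrite !mxE ffunE.
have EZ : 'E_Q[f \o (fun w => \row_i (Z i w)%:R)]%E = (vector_mean Z g)%:E.
  rewrite -(expectation_rv_vector Z gM); congr expectation.
  by apply/funext => w /=; congr f; apply/rowP => i; rewrite !mxE ffunE.
rewrite EZ; under eq_fun do rewrite EX.
apply: cvg_EFin; first exact: nearW.
apply: (mono_number_cvg c_gt0 c_cvg
  (copies_card c_gt0 mean_cvg var_cvg) mean_cvg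
  (copies_overlap_cvg nonisom edges_cvg c_cvg c_gt0 mean_cvg var_cvg)
  (joint_law_rec lambda_ge0 Z_pois Z_indep) (joint_law_ge0 Z) (box_joint_law_le1 Z)
  (joint_law_tight Z) gM) => B.
rewrite (box_joint_law Z _ gM) box_joint_law1.
exact: vector_mean_truncate.
Qed.
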